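(* Let $n=2r$ be an even integer with $n\ge 4$ and let $F$ be a field with $\operatorname{char}F=0$ or $\operatorname{char}F>r$. Let $V$ be the scheme over $\operatorname{Spec}F$ defined in the context, with coordinate ring $F[V]$. Then the products of pfaffians $[T]\in F[V]$, indexed by the symplectic standard even-tableaux $T$ with entries in $\mathbf n$, form an $F$-basis of $F[V]$ (that is, the family $([T])_T$ is a basis of $F[V]$ as an $F$-vector space).
   Context: Index set: $\mathbf n=\{1,2,\dots,n\}=\{1,\dots,r,\overline1,\dots,\overline r\}$, where $\overline i:=r+i$ for $1\le i\le r$. $J$ is the $n\times n$ matrix $J=\begin{bmatrix}0&I_r\\-I_r&0\end{bmatrix}$. For a commutative ring $R$ with unity, $V$ is the scheme over $\operatorname{Spec}R$ of $n\times n$ matrices $Y=(Y_{ij})$ such that $Y=-Y^T$, $Y_{ii}=0$ for all $i$, $Y^TJY=0$, and $\operatorname{char}_{(-JY)}(T)=T^n$ (characteristic polynomial of $-JY$). So $R[V]$ is the quotient of the polynomial ring $R[Y_{ij}:1\le i,j\le n]$ by the ideal generated by the polynomial equations these conditions impose on the entries. Here $R=F$. Tableaux: for a partition $\lambda=(\lambda_1\ge\dots\ge\lambda_k>0)$, a tableau $T$ of shape $\lambda$ is a map $T:\{(s,t):1\le s\le k,\ 1\le t\le\lambda_s\}\to\mathbf n$, pictured as an array in which row $s$ is $T(s,1),\dots,T(s,\lambda_s)$. Order $\mathbf n$ by $\overline1\prec1\prec\overline2\prec2\prec\dots\prec\overline r\prec r$. $T$ is standard if its entries strictly increase along each row and weakly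 increase down each column with respect to $\prec$. $T$ is symplectic standard if it is standard and, for each $1\le p\le r$, the indices $p$ and $\overline p$ appear only in the first $p$ columns. $T$ is an even-tableau if all row lengths $\lambda_s$ are even. For $i_1,\dots,i_{2l}\in\mathbf n$, $[i_1,\dots,i_{2l}]$ denotes the pfaffian of the $2l\times 2l$ skew-symmetric matrix $(Y_{i_ai_b})_{1\le a,b\le 2l}$. The pfaffian of a $2s\times 2s$ skew-symmetric matrix $A$ with zero diagonal is $\mathrm{Pf}(A)=\sum_\sigma \mathrm{sgn}(\sigma)\prod_{i=1}^sA_{\sigma(2i-1)\sigma(2i)}$, summed over permutations $\sigma$ of $\{1,\dots,2s\}$ with $\sigma(1)<\sigma(3)<\dots<\sigma(2s-1)$ and $\sigma(2i-1)<\sigma(2i)$ for all $i$. For an even-tableau $T$ of shape $\lambda=(\lambda_1,\dots,\lambda_k)$, $[T]:=\prod_{s=1}^k[T(s,1),\dots,T(s,\lambda_s)]$, viewed as an element of the coordinate ring. The empty tableau counts as a symplectic standard even-tableau, with $[\emptyset]=1$. *)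

(* Defs.v *)
From HB Require Import structures.
From mathcomp Require Import all_boot all_order all_algebra all_fingroup.
From mathcomp Require Import generic_quotient ring_quotient boolp.
From mathcomp Require Import mpoly.

Set Implicit Arguments.
Unset Strict Implicit.
Unset Printing Implicit Defensive.

Import GRing.Theory.

Local Open Scope ring_scope.
Local Open Scope quotient_scope.

Section Basis.
Variables (F : fieldType) (M : lmodType F) (I : choiceType).

Definition spanning (v : I -> M) : Prop :=
  forall x : M, exists (s : seq I) (c : I -> F), x = \sum_(i <- s) c i *: v i.

Definition lin_indep (v : I -> M) : Prop :=
  forall (s : seq I) (c : I -> F),
    uniq s -> \sum_(i <- s) c i *: v i = 0 -> forall i, i \in s -> c i = 0.

Definition is_basis (v : I -> M) : Prop := spanning v /\ lin_indep v.

End Basis.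

Section Pfaffian.

Lemma pf_fst_subproof m (i : 'I_m./2) : (i.*2 < m)%N.
Proof.
have := ltn_ord i; rewrite -ltn_double => /leq_trans; apply.
by rewrite -[leqRHS]odd_double_half leq_addl.
Qed.

Lemma pf_snd_subproof m (i : 'I_m./2) : (i.*2.+1 < m)%N.
Proof.
have := ltn_ord i; rewrite -leq_double doubleS => /leq_trans; apply.
by rewrite -[leqRHS]odd_double_half leq_addl.
Qed.

(* The i-th pair of consecutive positions: 2i-1 and 2i when counting from 1,
   hence i.*2 and i.*2.+1 here. *)
Definition pf_fst m (i : 'I_m./2) : 'I_m := Ordinal (pf_fst_subproof i).
Definition pf_snd m (i : 'I_m./2) : 'I_m := Ordinal (pf_snd_subproof i).

Definition pf_perm m (s : 'S_m) : bool :=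
  [forall i : 'I_m./2, (s (pf_fst i) < s (pf_snd i))%N] &&
  [forall i : 'I_m./2, forall j : 'I_m./2,
     (i < j)%N ==> (s (pf_fst i) < s (pf_fst j))%N].

(* Only meaningful when m is even. *)
Definition pfaffian (A : comNzRingType) m (M : 'M[A]_m) : A :=
  \sum_(s : 'S_m | pf_perm s)
    (-1) ^+ s * \prod_(i < m./2) M (s (pf_fst i)) (s (pf_snd i)).

End Pfaffian.

(* The index set {1, ..., r, 1bar, ..., rbar} is 'I_(r + r). For k : 'I_r, the
   index k + 1 is lshift r k and its barred copy is rshift r k. *)
Section Tableaux.
Variable r : nat.
Implicit Types (i : 'I_(r + r)) (T : seq (seq 'I_(r + r))).

(* The p in {1, ..., r} such that i is p or its barred copy. *)
Definition ind_abs i : nat :=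
  match split i with inl p => p.+1 | inr p => p.+1 end.

(* The position of i in the order 1bar < 1 < 2bar < 2 < ... < rbar < r. *)
Definition ind_rank i : nat :=
  match split i with inl p => p.*2.+1 | inr p => p.*2 end.

(* A tableau is the list of its rows, so that [shape T] is the underlying
   partition. *)
Definition is_tableau T : bool :=
  sorted geq (shape T) && (0%N \notin shape T).

(* The t-th column of T, read downwards, with t counted from 0. *)
Definition column T (t : nat) : seq 'I_(r + r) :=
  pmap (fun row => onth row t) T.

Definition width T : nat := head 0%N (shape T).

Definition standard T : bool :=
  all (sorted (fun i j => ind_rank i < ind_rank j)%N) T &&
  all (fun t => sorted (fun i j => ind_rank i <= ind_rank j)%N (column T t))
      (iota 0 (width T)).

Definition symplectic_standard T : bool :=
  standard T &&
  all (fun t => all (fun i => t.+1 <= ind_abs i)%N (column T t))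
      (iota 0 (width T)).

Definition even_tableau T : bool := all (fun l => ~~ odd l) (shape T).

Definition symp_even_tableau : Type :=
  {T : seq (seq 'I_(r + r)) |
    [&& is_tableau T, symplectic_standard T & even_tableau T]}.

End Tableaux.

Section Ideal.
Variable A : comNzRingType.

Definition ideal_gen (S : A -> Prop) (x : A) : Prop :=
  exists cs : seq (A * A),
    (forall c, c \in cs -> S c.2) /\ x = \sum_(c <- cs) c.1 * c.2.

Lemma ideal_gen0 S : ideal_gen S 0.
Proof. by exists [::]; split=> //; rewrite big_nil. Qed.

Lemma ideal_genMD S a x y :
  ideal_gen S x -> ideal_gen S y -> ideal_gen S (a * x + y).
Proof.
move=> [cs [csS ->]] [ds [dsS ->]].
exists ([seq (a * c.1, c.2) | c <- cs] ++ ds); split.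
  move=> c; rewrite mem_cat => /orP[/mapP[d dcs ->]|]; last exact: dsS.
  exact: (csS d).
rewrite big_cat big_map /= mulr_sumr; congr (_ + _).
by apply: eq_bigr => c _; rewrite mulrA.
Qed.

End Ideal.

Section Scheme.
Variables (r : nat) (R : comNzRingType).

Local Notation coord_poly := {mpoly R[(r + r) * (r + r)]}.

Definition Jmx (A : pzRingType) : 'M[A]_(r + r) :=
  block_mx 0 1%:M (- 1%:M) 0.

(* The variable Y_ij is the one numbered [mxvec_index i j]. *)
Definition genY : 'M[coord_poly]_(r + r) :=
  \matrix_(i, j) 'X_(mxvec_index i j).

Inductive V_equation : coord_poly -> Prop :=
| V_skew i j : V_equation ((genY + genY^T) i j)
| V_diag i : V_equation (genY i i)
| V_isotropic i j : V_equation ((genY^T *m Jmx coord_poly *m genY) i j)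
| V_char_poly k :
    V_equation ((char_poly (- (Jmx coord_poly *m genY)) - 'X^(r + r))`_k).

Definition V_ideal : coord_poly -> bool := fun p => `[< ideal_gen V_equation p >].

(* The zero matrix is a point of V, so the ideal is proper. *)
Lemma V_equation_eval0 (p : coord_poly) :
  V_equation p -> p.@[fun=> 0 : R] = 0.
Proof.
have evY : map_mx (meval (fun=> 0 : R)) genY = 0.
  by apply/matrixP => i j; rewrite !mxE mevalXU.
have evYij i j : (genY i j).@[fun=> 0 : R] = 0.
  by have /matrixP/(_ i j) := evY; rewrite !mxE.
case=> {p} [i j|i|i j|k].
- by rewrite mxE mevalD [genY^T i j]mxE !evYij addr0.
- exact: evYij.
- rewrite mxE raddf_sum big1 //= => l _.
  by rewrite mevalM evYij mulr0.
- rewrite -[LHS](coef_map (meval (fun=> 0 : R))).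
  rewrite rmorphB /= map_char_poly map_polyXn map_mxN map_mxM evY.
  rewrite mulmx0 oppr0 /char_poly /char_poly_mx map_mx0 subr0 det_scalar.
  by rewrite subrr coef0.
Qed.

Lemma V_ideal_closed : idealr_closed V_ideal.
Proof.
split=> [||a u v].
- exact/asboolP/ideal_gen0.
- apply/asboolP => -[cs [csV E]].
  have : (1 : coord_poly).@[fun => 0 : R] = 0.
    rewrite E raddf_sum big1_seq //= => c ccs.
    by rewrite mevalM (V_equation_eval0 (csV c ccs)) mulr0.
  by move/eqP; rewrite meval1 oner_eq0.
- by move=> /asboolP Iu /asboolP Iv; apply/asboolP/ideal_genMD.
Qed.

HB.instance Definition _ := isIdealr.Build coord_poly V_ideal V_ideal_closed.

Definition V_idealr : idealr coord_poly := Idealr.clone _ V_ideal _.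

Definition coord_ring : Type := {ideal_quot V_idealr}.

HB.instance Definition _ := GRing.ComNzRing.on coord_ring.

Definition V_class (p : coord_poly) : coord_ring := \pi_{ideal_quot V_idealr} p.

Lemma V_class_is_zmod_morphism : zmod_morphism V_class.
Proof. by move=> p q; rewrite /V_class rmorphB. Qed.

Lemma V_class_is_monoid_morphism : monoid_morphism V_class.
Proof. by split=> [|p q]; rewrite /V_class ?rmorph1 ?rmorphM. Qed.

HB.instance Definition _ :=
  GRing.isZmodMorphism.Build coord_poly coord_ring V_class
    V_class_is_zmod_morphism.
HB.instance Definition _ :=
  GRing.isMonoidMorphism.Build coord_poly coord_ring V_class
    V_class_is_monoid_morphism.

Definition V_scale (c : R) (x : coord_ring) : coord_ring :=
  V_class c%:MP * x.

Lemma V_scaleA a b x : V_scale a (V_scale b x) = V_scale (a * b) x.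
Proof. by rewrite /V_scale mulrA -rmorphM mpolyCM. Qed.

Lemma V_scale1 : left_id 1 V_scale.
Proof. by move=> x; rewrite /V_scale rmorph1 mul1r. Qed.

Lemma V_scaleDr : right_distributive V_scale +%R.
Proof. by move=> a x y; rewrite /V_scale mulrDr. Qed.

Lemma V_scaleDl x : {morph V_scale^~ x : a b / a + b}.
Proof. by move=> a b; rewrite /V_scale mpolyCD rmorphD mulrDl. Qed.

HB.instance Definition _ :=
  GRing.Zmodule_isLmodule.Build R coord_ring
    V_scaleA V_scale1 V_scaleDr V_scaleDl.

(* [i_1, ..., i_2l] for the row w = (i_1, ..., i_2l). *)
Definition pf_row (w : seq 'I_(r + r)) : coord_poly :=
  pfaffian (\matrix_(a < size w, b < size w)
              genY (tnth (in_tuple w) a) (tnth (in_tuple w) b)).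

Definition pf_tableau (T : seq (seq 'I_(r + r))) : coord_ring :=
  V_class (\prod_(w <- T) pf_row w).

End Scheme.

(* Main.v *)
Require Import Defs.
From HB Require Import structures.
From mathcomp Require Import all_boot all_order all_algebra all_fingroup.
From mathcomp Require Import generic_quotient ring_quotient boolp.
From mathcomp Require Import mpoly.
From mathcomp Require Import ring zify.

(** The pfaffian of a word [w] in the indices is developed along its first
letter: [pf M (x :: w)] contracts the covector [M x] with the alternating
function [pf M] ([der]).  All identities between pfaffians below come from
manipulating such contractions, so that no signs of permutations appear.

The products of pfaffians of symplectic standard tableaux span, because two
kinds of relations rewrite every other product.

Straightening ([straighten]).  Fix words A, B, C, split C in all ways as a
shuffle of U and V, and add up, with the sign of the shuffle and a weight
c(|VB|), the products [UA][VB].  Develop along the first letter of C.  A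
partner inside C can be reached both from U and from V, so it contributes the
sum of two consecutive values of c; a partner in A or in B at most
shifts c.
Hence the whole sum vanishes as soon as C is long enough compared with A and B
and c is killed by enough of these differences ([quad_vanish]).  For
rows (a_1 < ... < a_k) and (b_1 < ... < b_m), m <= k, with a_t > b_t, take C =
(a_t, ..., a_k, b_1, ..., b_t).  An integer-valued c that is 1 at m and 0 at
all sizes of the same parity above m and up to k ([interpolation]) expresses
the product of the two rows through products with a longer longest row and
products of the same shape whose first row has smaller entries.

The symplectic relation ([symplectic_step]).  Since Y^T J Y = 0 and the trace
of JY is 0, the sum over q of [q, qbar, I] is 0 for every word I
([pair_pf_rel]).  If a row has too many entries among the first p pairs, then
it contains more full pairs A than it misses pairs Z among these.  The pairs
act as commuting symbols of square zero whose sum is zero, so up to sign and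
up to rows containing a pair beyond p, the j-th power of the sum over A
(which is j! times the row, j = |A|) equals a product containing the
(|Z|+1)-st power of the sum over Z, which is zero ([elimination]).  Here j! has
to be inverted, and 2 for the trace; whence the condition on the characteristic.

The symplectic step increases a weight that grows exponentially with the
rank of the entries and is invariant under straightening; straightening then
increases the sum of the squares of the row lengths, or moves weight from a row
to one that is shorter, or equally long but heavier.  So the rewriting stops ([better_ind]).

These products are independent, because at a suitable point of V over a polynomial ring
their leading monomials are distinct.  Let L be a generic unitriangular and S a
generic symmetric matrix; the columns of [(L^-1)^T S ; L] span an isotropic
subspace.  Scale column t by a variable, and let Y be the sum of the
2-forms given by the columns 0 and 1, 2 and 3, and so on.  The variables can be
weighted so that the entry in row i and column t has weight at most
(r - t) * (2r - rank i), and equals a monomial of this weight up to smaller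
terms whenever the symplectic condition allows i in column t.  By the
rearrangement inequality the leading monomial of the pfaffian of an admissible
row is the product of the diagonal entries ([pf_form_lead]).  The leading
monomial of a tableau therefore records the content of each column, which
determines the tableau ([tab_mono_inj]). *)

Set Implicit Arguments.
Unset Strict Implicit.
Unset Printing Implicit Defensive.

Import GRing.Theory.

Local Open Scope ring_scope.

(** * Contractions and pfaffians of words *)

Section Contraction.
Variables (R : comNzRingType) (I : Type).
Implicit Types (u v : I -> R) (f g : seq I -> R) (X : seq I).

(** The contraction of the alternating function [f] with the covector [v]:
the alternating sum of [v x * f (X minus x)] over the letters [x] of [X]. *)
Fixpoint der v f X : R :=
  if X is x :: X' then v x * f X' - der v (fun Z => f (x :: Z)) X' else 0.

Lemma der_ext v f g X :
  (forall Z, (size Z).+1 = size X -> f Z = g Z) -> der v f X = der v g X.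
Proof.
elim: X f g => //= x X IH f g efg; rewrite efg //; congr (_ - _).
by apply: IH => Z sZ; apply: efg => /=; rewrite sZ.
Qed.

Lemma eq_der u v f X : u =1 v -> der u f X = der v f X.
Proof. by move=> euv; elim: X f => //= x X IH f; rewrite euv IH. Qed.

Lemma derD v f g X : der v (fun Z => f Z + g Z) X = der v f X + der v g X.
Proof. elim: X f g => /= [|x X IH] f g; first by rewrite addr0.
by rewrite IH; ring. Qed.

Lemma derZ v (a : R) f X : der v (fun Z => a * f Z) X = a * der v f X.
Proof. by elim: X f => /= [|x X IH] f; rewrite ?mulr0 // IH; ring. Qed.

Lemma derN v f X : der v (fun Z => - f Z) X = - der v f X.
Proof. by elim: X f => /= [|x X IH] f; rewrite ?oppr0 // IH; ring. Qed.

Lemma der0 v f X : (forall Z, (size Z).+1 = size X -> f Z = 0) -> der v f X = 0.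
Proof.
elim: X f => //= x X IH f f0; rewrite f0 // mulr0 IH ?subr0 // => Z sZ.
by apply: f0 => /=; rewrite sZ.
Qed.

(** A contraction is a skew derivation with respect to concatenation. *)
Lemma der_cat v f X Z :
  der v f (X ++ Z) = der v (fun X' => f (X' ++ Z)) X
     + (-1) ^+ size X * der v (fun Z' => f (X ++ Z')) Z.
Proof.
elim: X f => /= [|x X IH] f; first by rewrite add0r expr0 mul1r.
by rewrite IH exprS; ring.
Qed.

Lemma der_add u v f X : der (fun x => u x + v x) f X = der u f X + der v f X.
Proof. by elim: X f => /= [|x X IH] f; rewrite ?addr0 // IH; ring. Qed.

Lemma der_scale (a : R) u f X : der (fun x => a * u x) f X = a * der u f X.
Proof. by elim: X f => /= [|x X IH] f; rewrite ?mulr0 // IH; ring. Qed.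

Lemma der_sgn v f X :
  der v (fun Z => (-1) ^+ size Z * f Z) X = - (-1) ^+ size X * der v f X.
Proof.
rewrite (@der_ext _ _ (fun Z => - (-1) ^+ size X * f Z)) ?derZ // => Z sZ.
by rewrite -sZ exprS; ring.
Qed.

(** Contractions by different covectors anticommute because the two new
terms created by a letter are antisymmetric in [u] and [v]. *)
Lemma der2_cons u v f x X :
  der u (der v f) (x :: X) =
    u x * der v f X - v x * der u f X + der u (der v (fun Z => f (x :: Z))) X.
Proof. by rewrite /= derD derN derZ; ring. Qed.

Lemma der_anti u v f X : der u (der v f) X = - der v (der u f) X.
Proof.
elim: X f => [|x X IH] f; first by rewrite oppr0.
by rewrite !der2_cons IH; ring.
Qed.

Lemma der_sq v f X : der v (der v f) X = 0.
Proof.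
elim: X f => [|x X IH] f //.
by rewrite der2_cons IH; ring.
Qed.

Lemma der_swap n v f :
  (forall U (x y : I) V, (size U + size V).+1 = n ->
     f (U ++ x :: y :: V) = - f (U ++ y :: x :: V)) ->
  forall U (x y : I) V, (size U + size V)%N = n ->
     der v f (U ++ x :: y :: V) = - der v f (U ++ y :: x :: V).
Proof.
move=> falt U; elim: U n f falt => [|u U IH] n f falt x y V /= sUV.
  rewrite (@der_ext _ (fun Z => f (x :: y :: Z)) (fun Z => - f (y :: x :: Z))).
    by rewrite derN; ring.
  by move=> Z sZ; apply: (falt [::]); rewrite /= sZ.
rewrite (falt U) -?sUV // (IH n.-1 (fun Z => f (u :: Z))).
- by ring.
- by move=> U' x' y' V' s'; apply: (falt (u :: U')); rewrite /=; lia.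
- by lia.
Qed.

Lemma der_dup n v f :
  (forall U (x : I) V, (size U + size V).+1 = n ->
     f (U ++ x :: x :: V) = 0) ->
  forall U (x : I) V, (size U + size V)%N = n ->
     der v f (U ++ x :: x :: V) = 0.
Proof.
move=> falt U; elim: U n f falt => [|u U IH] n f falt x V /= sUV.
  rewrite (@der_ext _ (fun Z => f (x :: x :: Z)) (fun Z => 0 * f Z)).
    by rewrite derZ; ring.
  by move=> Z sZ; rewrite mul0r; apply: (falt [::]); rewrite /= ?sZ.
rewrite (falt U) -?sUV // (IH n.-1 (fun Z => f (u :: Z))).
- by ring.
- move=> U1 x1 V1 s1; apply: (falt (u :: U1)) => /=; lia.
- by lia.
Qed.

End Contraction.

Section Pf.
Variables (R : comNzRingType) (I : Type) (M : I -> I -> R).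

(** The length of the word serves as fuel: contracting does not recurse on a
subterm. *)
Fixpoint pf_rec n (w : seq I) : R :=
  match w, n with
  | [::], _ => 1
  | x :: w', n'.+1 => der (M x) (pf_rec n') w'
  | _, _ => 0
  end.

Definition pf w := pf_rec (size w) w.

Lemma pf_rec_stable n m w :
  (size w <= n)%N -> (size w <= m)%N -> pf_rec n w = pf_rec m w.
Proof.
elim: n w m => [|n IH] [|x w] [|m] //= sw sm.
by apply: der_ext => Z sZ; apply: IH; lia.
Qed.

Lemma pf_cons x w : pf (x :: w) = der (M x) pf w.
Proof. by rewrite /pf /=; apply: der_ext => Z sZ; apply: pf_rec_stable; rewrite -?sZ. Qed.

Lemma pf_nil : pf [::] = 1. Proof. by []. Qed.

(** A letter is always removed together with a partner. *)
Lemma pf_odd w : odd (size w) -> pf w = 0.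
Proof.
move: {2}(size w) (leqnn (size w)) => n; elim: n w => [|n IH] [|x w] //= sw ow.
rewrite pf_cons; apply: der0 => Z sZ; apply: IH; first by lia.
by move: ow; rewrite -sZ /= negbK.
Qed.

Lemma pf_sgn w : (-1) ^+ size w * pf w = pf w.
Proof.
case o: (odd (size w)); first by rewrite pf_odd ?mulr0.
by rewrite -signr_odd o mul1r.
Qed.

Hypothesis Mskew : forall x y, M x y = - M y x.
Hypothesis Mdiag : forall x, M x x = 0.

Lemma pf_cons2 x y w : pf (x :: y :: w) = M x y * pf w - der (M x) (der (M y) pf) w.
Proof. by rewrite pf_cons /=; congr (_ - _); apply: der_ext => Z _; rewrite pf_cons. Qed.

Lemma pf_swap U x y V : pf (U ++ x :: y :: V) = - pf (U ++ y :: x :: V).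
Proof.
move: {2}(_ + _)%N (leqnn (size U + size V)) => n.
elim: n U x y V => [|n IH] [|u U] x y V //= sUV.
1,2: by rewrite !pf_cons2 Mskew der_anti; ring.
rewrite !pf_cons; apply: (@der_swap _ _ (size U + size V)); last by [].
by move=> U' x' y' V' s'; apply: IH; lia.
Qed.

Lemma pf_dup U x V : pf (U ++ x :: x :: V) = 0.
Proof.
move: {2}(_ + _)%N (leqnn (size U + size V)) => n.
elim: n U x V => [|n IH] [|u U] x V //= sUV.
1,2: by rewrite !pf_cons2 Mdiag der_sq; ring.
rewrite !pf_cons; apply: (@der_dup _ _ (size U + size V)); last by [].
by move=> U' x' V' s'; apply: IH; lia.
Qed.

End Pf.

Section PfPerm.
Variables (R : comNzRingType) (I : eqType) (M : I -> I -> R).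
Hypothesis Mskew : forall x y, M x y = - M y x.
Hypothesis Mdiag : forall x, M x x = 0.

Lemma pf_move U x V W :
  exists b : bool, pf M (U ++ V ++ x :: W) = (-1) ^+ b * pf M (U ++ x :: V ++ W).
Proof.
elim: V U => [|v V IH] U; first by exists false; rewrite mul1r.
have [b] := IH (rcons U v); rewrite !cat_rcons => E; exists (~~ b).
by rewrite /= E pf_swap // signrN; ring.
Qed.

(** The sign is left unspecified, as spans of pfaffians do not see it. *)
Lemma pf_perm_eq w w' : perm_eq w w' ->
  exists b : bool, pf M w = (-1) ^+ b * pf M w'.
Proof.
rewrite -[w]cat0s -[w']cat0s; move: [::] => U.
elim: w w' U => [|x w IH] w' U.
  rewrite perm_cat2l perm_sym => /perm_nilP ->.
  by exists false; rewrite mul1r.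
rewrite perm_cat2l => p; have xw': x \in w' by rewrite -(perm_mem p) mem_head.
case/path.splitPr: xw' p => w1 w2 p.
have [b E] := pf_move U x w1 w2.
have [|c E'] := IH (w1 ++ w2) (rcons U x).
  by rewrite perm_cat2l -(perm_cons x) (permPl p) perm_catC /= perm_cons perm_catC.
exists (c (+) b); rewrite E -cat_rcons E' cat_rcons signr_addb.
by rewrite -!mulrA signrMK.
Qed.

Lemma not_uniq_perm (w : seq I) : ~~ uniq w -> exists x w', perm_eq w (x :: x :: w').
Proof.
elim: w => //= x w IH; rewrite negb_and negbK => /orP[xw|/IH[y [w' p]]].
  by exists x, (rem x w); rewrite perm_cons perm_to_rem.
exists y, (x :: w'); rewrite -(perm_cons x) in p; rewrite (permPl p).
by apply/seq.permP => a /=; lia.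
Qed.

Lemma pf_not_uniq w : ~~ uniq w -> pf M w = 0.
Proof.
move=> /not_uniq_perm[x [w' /pf_perm_eq[b ->]]].
by rewrite (pf_dup Mdiag [::]) mulr0.
Qed.

End PfPerm.

Section Shuffle.
Variables (R : comNzRingType) (I : Type).
Implicit Types (v : I -> R) (F : seq I -> seq I -> R) (C : seq I).

(** The signed sum of [F U V] over all ways to split [C] into two subwords
[U] and [V]; moving a letter to [V] past the letters already in [U] costs a
sign. *)
Fixpoint shuffle F C : R :=
  if C is x :: C' then
    shuffle (fun U V => F (x :: U) V) C'
    + shuffle (fun U V => (-1) ^+ size U * F U (x :: V)) C'
  else F [::] [::].

Lemma shuffle_ext F G C :
  (forall U V, (size U + size V)%N = size C -> F U V = G U V) ->
  shuffle F C = shuffle G C.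
Proof.
elim: C F G => [|x C IH] F G FG /=; first exact: FG.
congr (_ + _); apply: IH => U V sUV; rewrite FG //= ?sUV //; lia.
Qed.

Lemma shuffleD F G C :
  shuffle (fun U V => F U V + G U V) C = shuffle F C + shuffle G C.
Proof.
elim: C F G => [|x C IH] F G //=.
rewrite (@shuffle_ext (fun U V => (-1) ^+ size U * (F U (x :: V) + G U (x :: V)))
  (fun U V => (-1) ^+ size U * F U (x :: V) + (-1) ^+ size U * G U (x :: V))).
  by rewrite !IH addrACA.
by move=> U V _; rewrite mulrDr.
Qed.

Lemma shuffleZ (a : R) F C :
  shuffle (fun U V => a * F U V) C = a * shuffle F C.
Proof.
elim: C F => [|x C IH] F //=; rewrite mulrDr -!IH; congr (_ + _).
by apply: shuffle_ext => U V _; ring.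
Qed.

Lemma shuffle0 F C :
  (forall U V, (size U + size V)%N = size C -> F U V = 0) -> shuffle F C = 0.
Proof.
move=> F0; rewrite (@shuffle_ext F (fun U V => 0 * F U V)) ?shuffleZ ?mul0r //.
by move=> U V /F0 ->; rewrite mulr0.
Qed.

Lemma der_shuffle v (F : seq I -> seq I -> seq I -> R) C X :
  der v (fun Z => shuffle (F Z) C) X = shuffle (fun U V => der v (fun Z => F Z U V) X) C.
Proof.
elim: C F => [|x C IH] F //=; rewrite derD !IH; congr (_ + _).
by apply: shuffle_ext => U V _; rewrite derZ.
Qed.

(** Removing a letter of [U] after splitting or a letter of [C] before
splitting comes to the same thing. *)
Lemma der_shufflel v F C :
  der v (shuffle F) C = shuffle (fun U V => der v (F^~ V) U) C.
Proof.
elim: C F => [|x C IH] F //=.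
rewrite derD !IH.
rewrite (@shuffle_ext (fun U V => v x * F U V - der v (fun Z => F (x :: Z) V) U)
  (fun U V => v x * F U V + -1 * der v (fun Z => F (x :: Z) V) U)); last first.
  by move=> U V _; ring.
rewrite shuffleD !shuffleZ.
rewrite (@shuffle_ext (fun U V => der v (fun Z => (-1) ^+ size Z * F Z (x :: V)) U)
   (fun U V => -1 * ((-1) ^+ size U * der v (F^~ (x :: V)) U))).
  by rewrite shuffleZ; ring.
by move=> U V _; rewrite der_sgn; ring.
Qed.

Lemma der_shuffler v F C :
  der v (shuffle F) C = shuffle (fun U V => (-1) ^+ size U * der v (F U) V) C.
Proof.
elim: C F => [|x C IH] F /=; first by rewrite mulr0.
have sgn2 (U : seq I) (a : R) : (-1) ^+ size U * ((-1) ^+ size U * a) = a.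
  by rewrite mulrA -expr2 sqrr_sign mul1r.
rewrite derD !IH.
rewrite (@shuffle_ext (fun U V => (-1) ^+ (size U).+1 * der v (F (x :: U)) V)
   (fun U V => -1 * ((-1) ^+ size U * der v (F (x :: U)) V))); last first.
  by move=> U V _; rewrite exprS; ring.
rewrite (@shuffle_ext (fun U V => (-1) ^+ size U * ((-1) ^+ size U *
    (v x * F U V - der v (fun Z => F U (x :: Z)) V))) (fun U V => v x * F U V
    + -1 * ((-1) ^+ size U * der v (fun Z => (-1) ^+ size U * F U (x :: Z)) V))).
  by rewrite shuffleD !shuffleZ; ring.
by move=> U V _; rewrite derZ !sgn2; ring.
Qed.

Lemma shuffle_cat F C D :
  shuffle F (C ++ D) =
  shuffle (fun U V => shuffle (fun U' V' =>
     (-1) ^+ (size V * size U') * F (U ++ U') (V ++ V')) D) C.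
Proof.
elim: C F => [|x C IH] F /=.
  by apply: shuffle_ext => U V _; rewrite mul0n mul1r.
rewrite !IH; congr (_ + _).
apply: shuffle_ext => U V _; rewrite -shuffleZ; apply: shuffle_ext => U' V' _.
by rewrite size_cat exprD mulSn exprD; ring.
Qed.

End Shuffle.

(** * The quadratic relations between pfaffians *)

Section Quadratic.
Variables (R : comNzRingType) (I : Type) (M : I -> I -> R).
Implicit Types (c : nat -> R) (A B C : seq I).

(** Sizes of rows change by two when a pair of letters is removed. *)
Definition step2 c n := c n + c n.+2.

Lemma iter_step2_shift e c n :
  iter e step2 (fun i => c i.+2) n = iter e step2 c n.+2.
Proof. by elim: e n => //= e IH n; rewrite /step2 !IH. Qed.

Definition quad_term A B c U V := pf M (U ++ A) * (pf M (V ++ B) * c (size V + size B)%N).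

(** Since a word of odd length has pfaffian zero, signs that depend on the
length of a part of the word can be moved to the other part. *)
Lemma pf_sgn_cat (U Z : seq I) :
  (-1) ^+ size U * pf M (U ++ Z) = (-1) ^+ size Z * pf M (U ++ Z).
Proof.
rewrite -[in RHS](pf_sgn M (U ++ Z)) size_cat exprD.
by rewrite mulrA mulrCA -expr2 sqrr_sign mulr1.
Qed.

(** Every development step either lowers [e], when the two partners both lie
in [C], or shortens [A] or [B].  When [C] is longer than [A] and [B] together
by enough, the order [e] is used up first, and the weight is then zero. *)
Lemma quad_vanish e c A B C :
  iter e step2 c =1 (fun=> 0) -> (size A + size B + e.*2 < (size C).+2)%N ->
  shuffle (quad_term A B c) C = 0.
Proof.
move: {2}(size C) (leqnn (size C)) => n; elim: n e c A B C => [|n IH] e c A B C sC c0 sAB.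
  case: e c0 sAB => [|e] c0; last by rewrite doubleS; lia.
  by move=> _; apply: shuffle0 => U V _; rewrite /quad_term (c0 _ : c _ = 0) !mulr0.
case: e c0 sAB => [|e] c0 sAB.
  by apply: shuffle0 => U V _; rewrite /quad_term (c0 _ : c _ = 0) !mulr0.
case: C sC sAB => [|x C] /=; rewrite doubleS; first by lia.
move=> sC sAB.
(* T1 and T2 develop along x when it goes to U, respectively to V: the first
   summand pairs x with a letter of C, the second one with a letter of A or B. *)
pose F2 U V := pf M (U ++ A) * (pf M (V ++ B) * c (size V + size B).+2).
pose K V := pf M (V ++ B) * c (size V + size B)%N.
have T1 U V : quad_term A B c (x :: U) V = der (M x) (fun Z => quad_term A B c Z V) U
      + der (M x) (fun A' => (-1) ^+ size U * (pf M (U ++ A') * K V)) A.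
  rewrite /quad_term /= pf_cons der_cat -/(K V).
  rewrite -(derZ _ (_ ^+ _)) mulrDl mulrC [_ * K V]mulrC -!derZ.
  by congr (_ + _); apply: der_ext => Z _; ring.
have T2 U V : (size U + size V)%N = size C ->
  (-1) ^+ size U * quad_term A B c U (x :: V) = (-1) ^+ size U * der (M x) (F2 U) V
     + der (M x) (fun B' => (-1) ^+ size C * (pf M (U ++ A) *
          (pf M (V ++ B') * c (size V + size B').+2))) B.
  move=> <-; rewrite /quad_term /= pf_cons der_cat exprD.
  rewrite (@der_ext _ _ _ (F2 U) (fun Z => pf M (U ++ A) * c (size V + size B).+1
      * pf M (Z ++ B))); last first.
    by move=> Z sZ; rewrite /F2 -sZ addSn; ring.
  rewrite (@der_ext _ _ _ (fun B' => _ * (_ * (_ * c _)))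
      (fun B' => (-1) ^+ size U * (-1) ^+ size V * (pf M (U ++ A) * 
         c (size V + size B).+1) * pf M (V ++ B'))); last first.
    by move=> Z sZ; rewrite -sZ addnS; ring.
  by rewrite !derZ addSn; ring.
rewrite (shuffle_ext (fun U V _ => T1 U V)) (shuffle_ext T2).
(* Both ways to pair x with a letter of C give a contraction of the same kind,
   and their weights add up to [step2 c]. *)
rewrite !shuffleD -der_shufflel -der_shuffler -!der_shuffle addrACA -derD.
rewrite !der0 ?addr0 // => Z sZ.
- rewrite shuffleZ [shuffle _ _](IH e.+1 (fun i => c i.+2) A Z) ?mulr0 //.
  + by move=> k; rewrite iter_step2_shift c0.
  + by rewrite doubleS; lia.
- rewrite (@shuffle_ext _ _ _ (fun U V => (-1) ^+ size Z * quad_term Z B c U V)); last first.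
    by move=> U V _; rewrite mulrA pf_sgn_cat /quad_term /K; ring.
  rewrite shuffleZ (IH e.+1) ?mulr0 //.
  by rewrite doubleS; lia.
- rewrite -shuffleD; rewrite -(IH e (step2 c) A B Z); last 3 first.
  + by lia.
  + by move=> k; rewrite -iterSr.
  + by lia.
  by apply: shuffle_ext => U V _; rewrite /F2 /quad_term /step2; ring.
Qed.
End Quadratic.

(** The relations have integer coefficients, so all that the rewriting asks
of a span is to be an additive subgroup. *)
Definition subgroup_pred (R : zmodType) (P : R -> Prop) :=
  P 0 /\ forall x y, P x -> P y -> P (x - y).

Section SubgroupPred.
Variables (R : zmodType) (P : R -> Prop).
Hypothesis Pg : subgroup_pred P.

Lemma subgroup_predN x : P x -> P (- x).
Proof. by case: Pg => P0 PB Px; rewrite -sub0r; apply: PB. Qed.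

Lemma subgroup_predD x y : P x -> P y -> P (x + y).
Proof. by case: Pg => _ PB Px Py; rewrite -[y]opprK; apply: PB => //; apply: subgroup_predN. Qed.

Lemma subgroup_predMz x n : P x -> P (x *~ n).
Proof.
have [P0 _] := Pg.
suff sgMn k : P x -> P (x *+ k) by case: n => k Px; [|apply: subgroup_predN]; apply: sgMn.
by move=> Px; elim: k => [|k IH]; rewrite ?mulr0n // mulrS; apply: subgroup_predD.
Qed.

End SubgroupPred.

Lemma subgroup_pred_sign (R : pzRingType) (P : R -> Prop) (b : nat) x :
  subgroup_pred P -> P x -> P ((-1) ^+ b * x).
Proof.
by move=> Pg Px; rewrite -signr_odd mulr_sign; case: ifP => _ //; apply: subgroup_predN.
Qed.

Section ShufflePred.
Variables (R : comNzRingType) (I : eqType) (P : R -> Prop).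
Hypothesis Pg : subgroup_pred P.
Implicit Types (F : seq I -> seq I -> R) (C : seq I).

Lemma shuffle_closed F C :
  (forall U V, perm_eq (U ++ V) C -> P (F U V)) -> P (shuffle F C).
Proof.
elim: C F => [|x C IH] F PF /=; first exact: PF.
apply: (subgroup_predD Pg); apply: IH => U V p; first by apply: PF; rewrite /= perm_cons.
apply: subgroup_pred_sign => //; apply: PF.
by rewrite perm_catC /= perm_cons perm_catC.
Qed.

(** The term where all letters stay on the left has coefficient one. *)
Lemma shuffle_closed_head F C :
  (forall U V, perm_eq (U ++ V) C -> V != [::] -> P (F U V)) ->
  P (shuffle F C - F C [::]).
Proof.
elim: C F => [|x C IH] F PF /=; first by rewrite subrr; case: Pg.
rewrite addrAC; apply: (subgroup_predD Pg).
  by apply: IH => U V p V0; apply: PF; rewrite //= perm_cons.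
apply: shuffle_closed => U V p; apply: subgroup_pred_sign => //; apply: PF => //.
by rewrite perm_catC /= perm_cons perm_catC.
Qed.

Lemma shuffle_closed_tail F C :
  (forall U V, perm_eq (U ++ V) C -> U != [::] -> P (F U V)) ->
  P (shuffle F C - F [::] C).
Proof.
elim: C F => [|x C IH] F PF /=; first by rewrite subrr; case: Pg.
rewrite -addrA; apply: (subgroup_predD Pg).
  by apply: shuffle_closed => U V p; apply: PF; rewrite //= perm_cons.
rewrite -[X in _ - X]mul1r; apply: (IH (fun U V => (-1) ^+ size U * F U (x :: V))).
move=> U V p U0; apply: subgroup_pred_sign => //; apply: PF => //.
by rewrite perm_catC /= perm_cons perm_catC.
Qed.
End ShufflePred.

(** The solution of [step2 c =1 g] vanishing at 0 and 1. *)
Fixpoint step2_sol (g : nat -> int) n : int :=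
  if n is n'.+2 then g n' - step2_sol g n' else 0.

Lemma step2_solvable (g : nat -> int) m a :
  exists c, step2 c =1 g /\ c m = a.
Proof.
(* h spans the solutions of the homogeneous equation at sizes of the parity of m. *)
pose h n : int := (-1) ^+ n./2.
exists (fun n => step2_sol g n + (a - step2_sol g m) * h m * h n); split.
  by move=> n; rewrite /step2 /h /= exprS; ring.
have hh : h m * h m = 1 by rewrite /h -expr2 sqrr_sign.
by rewrite -mulrA hh; ring.
Qed.

Lemma eq_iter_step2 (R : comNzRingType) e (c c' : nat -> R) :
  c =1 c' -> iter e (@step2 _) c =1 iter e (@step2 _) c'.
Proof. by move=> cc'; elim: e => //= e IH n; rewrite /step2 !IH. Qed.

(** The analogue of a polynomial of degree [d] with prescribed values at
[d.+1] consecutive points: the solution for [d] is a signed antidifference of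
the solution for [d.-1], so it is integer-valued. *)
Lemma interpolation d m : exists c : nat -> int,
  [/\ iter d.+1 (@step2 _) c =1 (fun=> 0), c m = 1 &
      forall i, (0 < i <= d)%N -> c (m + i.*2)%N = 0].
Proof.
elim: d => [|d [c' [c'0 c'm c'i]]].
  have [c [c0 cm]] := step2_solvable (fun=> 0) m 1.
  by exists c; split=> // i; lia.
have [c [cc' cm]] := step2_solvable c' m 1.
exists c; split=> //.
  by move=> n; rewrite iterSr -(c'0 n); apply: eq_iter_step2.
move=> i; elim: i => // i IH /andP[_ id].
have := cc' (m + i.*2)%N; rewrite /step2 doubleS !addnS => E.
case: i => [|i] in IH id E *.
  by move: E; rewrite addn0 c'm cm; lia.
by move: E; rewrite IH ?c'i //; lia.
Qed.

Section Straighten.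
Variables (R : comNzRingType) (I : eqType) (M : I -> I -> R) (P : R -> Prop).
Hypothesis Pg : subgroup_pred P.

Lemma iter_step2_int (c : nat -> int) e n :
  iter e (@step2 _) (fun i => (c i)%:~R : R) n = (iter e (@step2 _) c n)%:~R.
Proof. by elim: e n => //= e IH n; rewrite /step2 !IH rmorphD. Qed.

(** All letters of [X] on the left and all letters of [Z] on the right is the
split that reproduces the given product.  The weight from [interpolation]
kills the splits into rows of intermediate lengths, which would be worse than
the given product for the dominance order. *)
Lemma straighten (A X Z B : seq I) :
  ~~ odd (size (X ++ A)) -> ~~ odd (size (Z ++ B)) ->
  (size (Z ++ B) <= size (X ++ A))%N -> (size A < size Z)%N ->
  (forall U V U' V', perm_eq (U ++ V) X -> perm_eq (U' ++ V') Z ->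
     let W := (U ++ U') ++ A in let W' := (V ++ V') ++ B in
     ~~ odd (size W') ->
     [|| (size W' < size (Z ++ B))%N, (size (X ++ A) < size W')%N |
       ((V != [::]) || (U' != [::])) && (size W == size (X ++ A))] ->
     P (pf M W * pf M W')) ->
  P (pf M (X ++ A) * pf M (Z ++ B)).
Proof.
set k := size (X ++ A); set m := size (Z ++ B) => ok om mk AZ PW.
(* The sizes m + 2, ..., k of the second row have to be suppressed. *)
pose d := (k - m)./2.
have [c [c0 cm ci]] := interpolation d m.
pose cR i : R := (c i)%:~R.
pose F := quad_term M A B cR.
have sk : k = (size X + size A)%N by rewrite /k size_cat.
have sm : m = (size Z + size B)%N by rewrite /m size_cat.
have PF U V U' V' : perm_eq (U ++ V) X -> perm_eq (U' ++ V') Z ->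
  (V != [::]) || (U' != [::]) -> P (F (U ++ U') (V ++ V')).
  move=> pX pZ ne; rewrite /F /quad_term.
  case o: (odd (size ((V ++ V') ++ B))).
    by rewrite [pf M ((V ++ V') ++ B)]pf_odd // mul0r mulr0; case: Pg.
  have s1 := perm_size pX; have s2 := perm_size pZ; rewrite !size_cat in s1 s2 o.
  rewrite /cR mulrA mulrzr; set W := (U ++ U') ++ A; set W' := (V ++ V') ++ B.
  have sW' : size W' = (size (V ++ V') + size B)%N by exact: size_cat.
  have sWW : (size W + size W' = k + m)%N by rewrite !size_cat; lia.
  have oW' : ~~ odd (size W') by rewrite sW' !size_cat o.
  rewrite -sW'; case: (boolP [|| size W' < m, k < size W' | size W' == m]%N) => big.
    apply: (subgroup_predMz Pg); apply: PW => //; rewrite -/W -/W' ne /=.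
    by case/or3P: big => [->|->|/eqP W'm]; rewrite ?orbT //; apply/or3P/Or33; lia.
  have -> : size W' = (m + (size W' - m)./2.*2)%N by lia.
  by rewrite ci ?mulr0z; [case: Pg | rewrite /d; lia].
have /= : shuffle F (X ++ Z) = 0.
  apply: (@quad_vanish _ _ _ d.+1).
    by move=> n; rewrite iter_step2_int c0.
  by rewrite doubleS size_cat; lia.
rewrite shuffle_cat.
set G := (X in shuffle X _) => G0.
have P1 : P (shuffle G X - G X [::]).
  apply: (shuffle_closed_head Pg) => U V pX V0; apply: (shuffle_closed Pg) => U' V' pZ.
  by apply: subgroup_pred_sign => //; apply: PF => //; rewrite V0.
have P2 : P (G X [::] - F X Z).
  have := @shuffle_closed_tail R I P Pg
    (fun U' V' => (-1) ^+ (@size I [::] * size U') * F (X ++ U') V') Z.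
  rewrite cats0 mul1r; apply => U' V' pZ U0.
  apply: subgroup_pred_sign => //; apply: (PF X [::] U' V') => //; rewrite ?cats0 //.
have := subgroup_predN Pg (subgroup_predD Pg P1 P2).
rewrite G0 addrA subrK sub0r opprK /F /quad_term.
by rewrite -sm /cR cm mulr1.
Qed.
End Straighten.

(** * Eliminating pairs *)

(** Developing the letters of [X] leaves only the bilinear expressions in two
letters that vanish by hypothesis. *)
Lemma der_contract (R : comNzRingType) (I : Type) (J : finType) (a b : J -> I -> R) f X :
  (forall x z, \sum_q (a q x * b q z - b q x * a q z) = 0) ->
  \sum_q der (a q) (der (b q) f) X = 0.
Proof.
move=> ab0.
have E x g Z : \sum_q (a q x * der (b q) g Z - b q x * der (a q) g Z) = 0.
  elim: Z g => [|z Z IH] g.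
    by rewrite big1 // => q _ /=; rewrite !mulr0 subrr.
  transitivity ((\sum_q (a q x * b q z - b q x * a q z)) * g Z -
     \sum_q (a q x * der (b q) (fun Y => g (z :: Y)) Z
           - b q x * der (a q) (fun Y => g (z :: Y)) Z)).
    by rewrite mulr_suml -sumrB; apply: eq_bigr => q _ /=; ring.
  by rewrite ab0 IH mul0r subr0.
elim: X f => [|x X IH] f; first by rewrite big1.
under eq_bigr do rewrite der2_cons.
by rewrite big_split /= E IH addr0.
Qed.

Section Elimination.
Variables (R : zmodType) (T : Type).
Implicit Types (S L : seq T) (h : seq T -> R).

(** With [h L] read as a product of commuting symbols, one for each letter of
[L], this is [L] times the [n]-th power of the sum of the symbols in [S]. *)
Fixpoint asum S n h L : R :=
  if n is n'.+1 then \sum_(q <- S) asum S n' h (q :: L) else h L.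

Lemma asum_inner S n h L :
  asum S n.+1 h L = asum S n (fun L' => \sum_(q <- S) h (q :: L')) L.
Proof. by elim: n L => //= n IH L; apply: eq_bigr => q _; rewrite -IH. Qed.

Lemma asumD S n h h' L :
  asum S n (fun L' => h L' + h' L') L = asum S n h L + asum S n h' L.
Proof.
by elim: n L => //= n IH L; rewrite -big_split; apply: eq_bigr => q _ /=; rewrite IH.
Qed.

Definition sym_fun h := forall U x y V, h (U ++ x :: y :: V) = h (U ++ y :: x :: V).
Definition sqfree_fun h := forall x V, h (x :: x :: V) = 0.

Lemma asum_sym S n h : sym_fun h -> sym_fun (asum S n h).
Proof.
move=> hs; elim: n => //= n IH U x y V; apply: eq_bigr => q _.
exact: (IH (q :: U)).
Qed.

Lemma sym_cons h x L L' : sym_fun h -> h (x :: L ++ L') = h (L ++ x :: L').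
Proof.
move=> hs; suff: forall U, h (U ++ x :: L ++ L') = h (U ++ L ++ x :: L') by move/(_ [::]).
elim: L => //= y L IH U; rewrite hs.
by have := IH (rcons U y); rewrite !cat_rcons.
Qed.

Lemma asum_sqfree S n h : sym_fun h -> sqfree_fun h -> sqfree_fun (asum S n h).
Proof.
move=> hs h2; elim: n => //= n IH x V; rewrite big1 // => q _.
have As := asum_sym S n hs.
by rewrite (As [::] q) (As [:: x] q) /= IH.
Qed.

(** The binomial formula, cut after two terms because squares vanish. *)
Lemma asum_cons S p n h L : sym_fun h -> sqfree_fun h ->
  asum (p :: S) n h L = asum S n h L + asum S n.-1 h (p :: L) *+ n.
Proof.
move=> hs h2; elim: n L => [|n IH] L /=; first by rewrite mulr0n addr0.
rewrite big_cons IH (asum_sqfree _ _ hs h2) mul0rn addr0.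
under eq_bigr do rewrite IH.
rewrite big_split /= addrCA; congr (_ + _); rewrite mulrS; congr (_ + _).
case: n {IH} => [|n] /=; first by rewrite big1.
rewrite -sumrMnl; apply: eq_bigr => q _; congr (_ *+ _).
exact: (asum_sym S n hs [::]).
Qed.

Lemma asum_pow S h n L : sym_fun h -> sqfree_fun h -> 
  ((size S < n)%N -> asum S n h L = 0) /\
  (n = size S -> asum S n h L = h (S ++ L) *+ n`!).
Proof.
move=> hs h2; elim: S n L => [|p S IH] n L /=.
  by split; [case: n => //= n _; rewrite big_nil | move=> -> /=].
split=> [lt|->]; rewrite asum_cons //.
  rewrite (proj1 (IH n L)) ?(proj1 (IH n.-1 _)) ?mul0rn ?addr0 //; lia.
rewrite (proj1 (IH _ L)) // add0r (proj2 (IH _ _)) // -mulrnA mulnC -factS.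
by rewrite sym_cons.
Qed.

Variable P : R -> Prop.
Hypothesis Pg : subgroup_pred P.

Lemma subgroup_pred_sum S (F : T -> R) : (forall q, P (F q)) -> P (\sum_(q <- S) F q).
Proof.
by move=> PF; elim/big_ind: _ => //; [case: Pg | exact: subgroup_predD].
Qed.

Lemma subgroup_pred_sum_cond (J : finType) (c : pred J) (F : J -> R) :
  (forall q, c q -> P (F q)) -> P (\sum_(q | c q) F q).
Proof.
by move=> PF; elim/big_ind: _ => //; [case: Pg | exact: subgroup_predD].
Qed.

(** With s(A), s(Z) the sums of the symbols, s(A) + s(Z) is zero modulo [P], so
s(A)^j is up to sign s(Z)^m s(A)^(j-m) for all m; at m = |Z| + 1 this is zero. *)
Lemma elimination (A Z : seq T) h j :
  sym_fun h -> sqfree_fun h -> j = size A -> (size Z < j)%N ->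
  (forall L, (size L).+1 = j -> P (\sum_(q <- A ++ Z) h (q :: L))) ->
  P (h A *+ j`!).
Proof.
move=> hs h2 jA Zj Prel.
(* s(Z)^m s(A)^(j - m) *)
pose B m := asum Z m (asum A (j - m) h) [::].
have P1 k L : (k + (size L).+1 = j)%N -> P (\sum_(q <- A ++ Z) asum A k h (q :: L)).
  elim: k L => [|k IH] L kL; first exact: Prel.
  rewrite /= exchange_big; apply: subgroup_pred_sum => p /=.
  under eq_bigr do rewrite (asum_sym A k hs [::]) /=.
  by apply: IH => /=; lia.
have P2 m G L : (forall L', size L' = (m + size L)%N -> P (G L')) -> P (asum Z m G L).
  elim: m L => [|m IH] L PG; first exact: PG.
  by apply: subgroup_pred_sum => q; apply: IH => L' sL'; apply: PG; rewrite sL' /=; lia.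
have BB m : (m < j)%N -> P (B m + B m.+1).
  move=> mj; rewrite /B asum_inner -(subnSK mj) -asumD.
  apply: P2 => L' sL' /=; rewrite -big_cat; apply: P1.
  by rewrite sL' /=; lia.
have BP m : (m <= (size Z).+1)%N -> P (B ((size Z).+1 - m)%N).
  elim: m => [|m IH] mZ.
    rewrite subn0 /B.
    rewrite (proj1 (asum_pow Z _ [::] (asum_sym A _ hs) (asum_sqfree A _ hs h2))) //.
    by case: Pg.
  have -> : ((size Z).+1 - m.+1 = size Z - m)%N by lia.
  rewrite -[B _](addrK (B (size Z - m).+1)).
  apply: (proj2 Pg); first by apply: BB; lia.
  have -> : ((size Z - m).+1 = (size Z).+1 - m)%N by lia.
  by apply: IH; lia.
have := BP _ (leqnn _); rewrite subnn /B subn0 /=.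
by rewrite (proj2 (asum_pow _ _ _ hs h2)) // cats0.
Qed.

End Elimination.

(** * Ranks, weights and pairs of indices *)

Section Ranks.
Variable r : nat.
Implicit Types (i j : 'I_(r + r)) (q : 'I_r) (w : seq 'I_(r + r)).

Lemma split_lshift q : split (lshift r q) = inl q.
Proof. exact: (unsplitK (inl q)). Qed.
Lemma split_rshift q : split (rshift r q) = inr q.
Proof. exact: (unsplitK (inr q)). Qed.

Lemma rank_lshift q : ind_rank (lshift r q) = q.*2.+1.
Proof. by rewrite /ind_rank split_lshift. Qed.
Lemma rank_rshift q : ind_rank (rshift r q) = q.*2.
Proof. by rewrite /ind_rank split_rshift. Qed.

Lemma ind_absE i : ind_abs i = (ind_rank i)./2.+1.
Proof. by rewrite /ind_abs /ind_rank; case: (split i) => q /=; rewrite ?uphalf_double ?doubleK. Qed.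

Lemma ind_rank_lt i : (ind_rank i < r.*2)%N.
Proof. by rewrite /ind_rank; case: (split i) => q; have := ltn_ord q; lia. Qed.

Lemma ind_rank_inj : injective (@ind_rank r).
Proof.
move=> i j; rewrite -(splitK i) -(splitK j).
by case: (split i) => p; case: (split j) => q; rewrite /= ?rank_lshift ?rank_rshift => E;
  (try by lia); congr (_ _ _); apply: val_inj => /=; lia.
Qed.

Definition rank_lt i j := (ind_rank i < ind_rank j)%N.
Definition rank_le i j := (ind_rank i <= ind_rank j)%N.

Lemma rank_lt_trans : transitive rank_lt.
Proof. by move=> j i k; apply: ltn_trans. Qed.
Lemma rank_lt_irr : irreflexive rank_lt.
Proof. by move=> i; apply: ltnn. Qed.

Lemma rank_lt_uniq w : sorted rank_lt w -> uniq w.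
Proof. exact: (sorted_uniq rank_lt_trans rank_lt_irr). Qed.

Lemma sort_rank_lt w : uniq w -> sorted rank_lt (sort rank_le w).
Proof.
move=> uw; have le_tot : total rank_le by move=> i j; apply: leq_total.
have : pairwise (fun i j => i != j) (sort rank_le w).
  by rewrite -uniq_pairwise sort_uniq.
have := sort_sorted le_tot w; elim: (sort _ _) => //= i s IH p /andP[ns pw].
have {IH} := IH (path_sorted p) pw.
case: s p ns {pw} => //= j s /andP[ij _] /andP[ne _] ->; rewrite andbT.
by rewrite /rank_lt ltn_neqAle [X in _ && X]ij andbT; apply: contra ne => /eqP/ind_rank_inj/eqP.
Qed.

(** Exponential in the rank, so that a single large entry outweighs any
number of distinct smaller ones. *)
Definition wt i := ((r.*2.+1) ^ ind_rank i)%N.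
Definition row_wt w := (\sum_(i <- w) wt i)%N.

Lemma row_wt_cat w w' : row_wt (w ++ w') = (row_wt w + row_wt w')%N.
Proof. by rewrite /row_wt big_cat. Qed.

Lemma row_wt_perm w w' : perm_eq w w' -> row_wt w = row_wt w'.
Proof. exact: perm_big. Qed.

Lemma row_wt_le w k : (forall i, i \in w -> ind_rank i <= k)%N ->
  (row_wt w <= size w * r.*2.+1 ^ k)%N.
Proof.
move=> wk; rewrite /row_wt -sum1_size mulnC big_distrr /=.
rewrite big_seq [in leqRHS]big_seq; apply: leq_sum => i iw.
by rewrite muln1 leq_pexp2l //; apply: wk.
Qed.

Lemma row_wt_ge w k : (forall i, i \in w -> k <= ind_rank i)%N ->
  (size w * r.*2.+1 ^ k <= row_wt w)%N.
Proof.
move=> wk; rewrite /row_wt -sum1_size mulnC big_distrr /=.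
rewrite big_seq [in leqRHS]big_seq; apply: leq_sum => i iw.
by rewrite muln1 leq_pexp2l //; apply: wk.
Qed.

Definition pairs (L : seq 'I_r) := flatten [seq [:: lshift r q; rshift r q] | q <- L].

Lemma pairs_cat L L' : pairs (L ++ L') = pairs L ++ pairs L'.
Proof. by rewrite /pairs map_cat flatten_cat. Qed.

Lemma size_pairs L : size (pairs L) = (size L).*2.
Proof. by elim: L => //= q L ->. Qed.

Lemma mem_pairs L i : (i \in pairs L) = ((match split i with inl q => q | inr q => q end) \in L).
Proof.
rewrite -(splitK i); elim: L => //= q L IH; rewrite !inE IH.
case: (split i) IH => p IH; rewrite /= ?split_lshift ?split_rshift.
  by rewrite eq_lshift eq_lrshift.
by rewrite eq_rlshift eq_rshift.
Qed.

End Ranks.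

(** * The symplectic relation on a row *)

Section PairCount.
Variable r : nat.
Implicit Types (w : seq 'I_(r + r)) (q : 'I_r).

Lemma uniq_pairs (L : seq 'I_r) : uniq L -> uniq (pairs L).
Proof.
elim: L => //= q L IH /andP[qL /IH ->].
rewrite inE !mem_pairs split_lshift split_rshift eq_lrshift /= (negPf qL).
by [].
Qed.

Definition full_pair w p q := [&& (q < p)%N, lshift r q \in w & rshift r q \in w].
Definition absent_pair w p q := [&& (q < p)%N, lshift r q \notin w & rshift r q \notin w].

Lemma sum_ltn p : (\sum_(q < r) (q < p)%N)%N = minn r p.
Proof.
by elim: r => [|k IH]; rewrite ?big_ord0 ?big_ord_recr /= ?IH; lia.
Qed.

(** Each [q < p] contributes one entry, plus one if its pair is full and
minus one if it is absent. *)
Lemma count_full_absent w p : uniq w ->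
  (count (fun i => ind_abs i <= p) w + count (absent_pair w p) (enum 'I_r)
    <= p + count (full_pair w p) (enum 'I_r))%N.
Proof.
move=> uw.
have -> : count (fun i => ind_abs i <= p)%N w =
  (\sum_(q < r) ((lshift r q \in w) && (q < p)%N)
   + \sum_(q < r) ((rshift r q \in w) && (q < p)%N))%N.
  transitivity (\sum_(i : 'I_(r + r)) ((i \in w) && (ind_abs i <= p)%N))%N; last first.
    rewrite big_split_ord /=; congr (_ + _)%N; apply: eq_bigr => q _.
      by rewrite ind_absE rank_lshift /= uphalf_double.
    by rewrite ind_absE rank_rshift doubleK.
  rewrite -size_filter -(card_uniqP (filter_uniq _ uw)) -sum1_card big_mkcond.
  by apply: eq_bigr => i _; rewrite mem_filter andbC; case: (_ && _).
have cnt (c : pred 'I_r) : count c (enum 'I_r) = (\sum_(q < r) c q)%N.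
  by rewrite -sum1_count big_mkcond big_enum; apply: eq_bigr => q _; case: (c q).
rewrite !cnt -!big_split /=.
apply: (@leq_trans (\sum_(q < r) ((q < p)%N + full_pair w p q)%N)).
  apply: leq_sum => q _; rewrite /full_pair /absent_pair.
  by case: (q < p)%N; case: (_ \in w); case: (_ \in w).
by rewrite big_split leq_add2r /= sum_ltn geq_minr.
Qed.
End PairCount.

Section PairFunction.
Variables (R : comNzRingType) (r : nat) (y : 'I_(r + r) -> 'I_(r + r) -> R).
Hypothesis yskew : forall i j, y i j = - y j i.
Hypothesis ydiag : forall i, y i i = 0.
Variable w0 : seq 'I_(r + r).

Definition pair_pf (L : seq 'I_r) := pf y (pairs L ++ w0).

(** A pair of letters passes another pair by four transpositions. *)
Lemma pair_pf_sym : sym_fun pair_pf.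
Proof.
move=> U p q V; rewrite /pair_pf !pairs_cat -!catA /=; set W := _ ++ w0.
set a := lshift r p; set b := rshift r p; set c := lshift r q; set d := rshift r q.
have S U' e f X : pf y (U' ++ e :: f :: X) = - pf y (U' ++ f :: e :: X) by exact: pf_swap.
move: (pairs U) => {}U.
have := S (rcons U a) b c (d :: W); rewrite !cat_rcons => ->.
have := S (rcons (rcons U c) a) b d W; rewrite !cat_rcons => E.
by rewrite (S U a) E; have := S (rcons U c) a d (b :: W); rewrite !cat_rcons => ->; rewrite !opprK.
Qed.

Lemma pair_pf_sqfree : sqfree_fun pair_pf.
Proof. by move=> q V; apply: pf_not_uniq => //=; rewrite !inE eqxx orbT. Qed.

Hypothesis yiso : forall x z, \sum_(q < r)
  (y (lshift r q) x * y (rshift r q) z - y (rshift r q) x * y (lshift r q) z) = 0.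
Hypothesis ytr : \sum_(q < r) y (lshift r q) (rshift r q) = 0.

(** The contraction of the exponential of Y with the symplectic form
vanishes: its scalar part is the trace and its quadratic part is Y^T J Y. *)
Lemma pair_pf_rel L : \sum_(q < r) pair_pf (q :: L) = 0.
Proof.
rewrite /pair_pf /=; under eq_bigr do rewrite pf_cons2.
by rewrite big_split /= sumrN der_contract // -mulr_suml ytr mul0r subr0.
Qed.
End PairFunction.

Section SympStep.
Variables (R : comNzRingType) (r : nat) (y : 'I_(r + r) -> 'I_(r + r) -> R).
Hypothesis yskew : forall i j, y i j = - y j i.
Hypothesis ydiag : forall i, y i i = 0.
Hypothesis yiso : forall x z, \sum_(q < r)
  (y (lshift r q) x * y (rshift r q) z - y (rshift r q) x * y (lshift r q) z) = 0.
Hypothesis ytr : \sum_(q < r) y (lshift r q) (rshift r q) = 0.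
Variable P : R -> Prop.
Hypothesis Pg : subgroup_pred P.
Hypothesis Pdiv : forall x j, (j <= r)%N -> P (x *+ j`!) -> P x.

(** The [t.+1] first entries have index at most [p <= t], which forces more
full pairs than absent ones below [p]. *)
Lemma symplectic_step (w : seq 'I_(r + r)) i0 t :
  sorted (@rank_lt r) w -> (t < size w)%N -> (ind_abs (nth i0 w t) <= t)%N ->
  (forall w', size w' = size w -> (row_wt w < row_wt w')%N -> P (pf y w')) ->
  P (pf y w).
Proof.
move=> sw tw; set p := ind_abs _ => pt Pw'.
have uw := rank_lt_uniq sw.
pose A := filter (full_pair w p) (enum 'I_r); pose Z := filter (absent_pair w p) (enum 'I_r).
have ZA : (size Z < size A)%N.
  have := count_full_absent p uw; rewrite /A /Z !size_filter.
  suff : (t.+1 <= count (fun i => ind_abs i <= p)%N w)%N by lia.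
  rewrite -[w](cat_take_drop t.+1) count_cat.
  rewrite (_ : count _ (take _ _) = t.+1) ?leq_addr //.
  have szt : size (take t.+1 w) = t.+1 by apply: size_takel.
  rewrite -[RHS]szt; apply/eqP; rewrite -all_count; apply/(all_nthP i0) => s.
  rewrite szt => st; rewrite nth_take //.
  rewrite /p !ind_absE ltnS; apply: half_leq.
  have [->//|nst] := eqVneq s t.
  have st' : (s < t)%N by rewrite ltn_neqAle nst.

  by apply/ltnW/(sorted_ltn_nth (@rank_lt_trans r) i0 sw) => //; rewrite inE // (ltn_trans st').
pose w0 := filter (fun i => i \notin pairs A) w.
have mA i : (i \in pairs A) -> i \in w.
  rewrite mem_pairs mem_filter => /andP[/and3P[_ lw rw] _].
  by rewrite -(splitK i); case: (split i) lw rw.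
have pw : perm_eq w (pairs A ++ w0).
  apply: uniq_perm => //.
    rewrite cat_uniq; apply/and3P; split; last exact: filter_uniq.
      by rewrite uniq_pairs // filter_uniq ?enum_uniq.
    by apply/hasPn => i; rewrite mem_filter => /andP[].
  move=> i; rewrite mem_cat mem_filter.
  by case: (boolP (i \in pairs A)) => [/mA ->|].
have sA : (size A <= r)%N.
  by rewrite /A size_filter; apply: leq_trans (count_size _ _) _; rewrite size_enum_ord.
have [b ->] := pf_perm_eq yskew pw; apply: subgroup_pred_sign => //.
apply: (Pdiv sA); rewrite -/(pair_pf y w0 A).
apply: (elimination (Z := Z) Pg (pair_pf_sym yskew w0) (pair_pf_sqfree yskew ydiag w0)) => // L sL.
have /eqP := pair_pf_rel w0 yiso ytr L.
rewrite (bigID (fun q => q \in A ++ Z)) /= -big_uniq /=; last first.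
  rewrite cat_uniq; apply/and3P; split; rewrite ?(filter_uniq _ (enum_uniq _)) //.
  apply/hasPn => q.
  by rewrite !mem_filter => /andP[/and3P[_ /negPf lw _] _]; rewrite /full_pair lw andbF.
rewrite addr_eq0 => /eqP ->; apply: (subgroup_predN Pg); apply: (subgroup_pred_sum_cond Pg) => q.
rewrite mem_cat [q \in A]mem_filter [q \in Z]mem_filter mem_enum !andbT negb_or => /andP[nf na].
(* A pair below p that is neither full nor absent shares a letter with w0; a
   pair beyond p makes the row heavier than w. *)
case: (ltnP q p) => qp.
  suff -> : pair_pf y w0 (q :: L) = 0 by case: Pg.
  apply: pf_not_uniq => //=.
  have nA i : i \in w -> (match split i with inl q => q | inr q => q end) = q -> i \in w0.
    by move=> iw iq; rewrite mem_filter iw mem_pairs iq mem_filter (negPf nf).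
  move: nf na; rewrite /full_pair /absent_pair qp /=.
  case lw : (lshift r q \in w) => /=.
    by rewrite !inE mem_cat nA ?orbT // split_lshift.
  case rw : (rshift r q \in w) => //= _ _.
  by rewrite mem_cat [X in _ || X]nA ?orbT ?andbF // split_rshift.
have p0 : (0 < p)%N by rewrite /p ind_absE.
apply: Pw'.
  by rewrite (perm_size pw) !size_cat !size_pairs -sL.
rewrite (row_wt_perm pw) !row_wt_cat ltn_add2r.
apply: (@leq_ltn_trans (size (pairs A) * r.*2.+1 ^ p.*2.-1)%N).
  apply: row_wt_le => i; rewrite mem_pairs mem_filter => /andP[/and3P[+ _ _] _].
  rewrite -(splitK i); case: (split i) => q' /=; 
   rewrite ?split_lshift ?split_rshift ?rank_lshift ?rank_rshift; lia.
apply: (@leq_trans (r.*2.+1 ^ p.*2)%N).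
  rewrite -{2}[p.*2]prednK; last by lia.
  rewrite expnS ltn_pmul2r ?expn_gt0 // size_pairs; lia.
rewrite /= -[rshift r q :: _]cat1s -cat1s !row_wt_cat.
apply: (@leq_trans (row_wt [:: rshift r q])); last by lia.
by rewrite /row_wt big_seq1 /wt rank_rshift leq_exp2l; lia.
Qed.
End SympStep.

(** * Standardness and termination *)

Lemma sorted_not_sorted (T : Type) (e1 e2 : rel T) (s : seq T) :
  sorted e1 s -> ~~ sorted e2 s ->
  exists s1 a b s2, [/\ s = s1 ++ a :: b :: s2, e1 a b & ~~ e2 a b].
Proof.
elim: s => //= a s IH; case: s IH => //= b s IH /andP[ab pb].
rewrite negb_and => /orP[nab|npb]; first by exists [::], a, b, s.
have [s1 [c [d [s2 [E cd ncd]]]]] := IH pb npb.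
by exists (a :: s1), c, d, s2; rewrite /= E.
Qed.

Lemma onth_some (T : Type) (x0 : T) s t : (t < size s)%N -> onth s t = Some (nth x0 s t).
Proof. by rewrite onthE => ts; rewrite (nth_map x0). Qed.

Section Tableau.
Variable r : nat.
Notation idx := 'I_(r + r).
Implicit Types (A B w : seq idx) (T : seq (seq idx)).

(** The relation between two consecutive rows of a standard tableau; the
default values are never read. *)
Definition dominates A B := (size B <= size A)%N &&
  [forall t : 'I_(size B),
     ind_rank (nth (tnth (in_tuple B) t) A t) <= ind_rank (tnth (in_tuple B) t)]%N.

Lemma dominatesP i0 A B :
  reflect ((size B <= size A)%N /\
    forall t, (t < size B)%N -> (ind_rank (nth i0 A t) <= ind_rank (nth i0 B t))%N)
    (dominates A B).
Proof.
apply: (iffP andP) => -[BA AB]; split=> //.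
  move=> t tB; have /= := forallP AB (Ordinal tB).
  by rewrite !(tnth_nth i0) /= (set_nth_default i0) // (leq_trans tB).
apply/forallP => t; have tB := ltn_ord t.
by rewrite !(tnth_nth i0) /= (set_nth_default i0) ?AB // (leq_trans tB).
Qed.

Lemma dominates_column i0 A T t : path dominates A T -> (t < size A)%N ->
  path (@rank_le r) (nth i0 A t) (column T t).
Proof.
elim: T A => //= B T IH A /andP[/(dominatesP i0)[BA AB] pB] tA.
case: (ltnP t (size B)) => tB.
  by rewrite (onth_some i0) //= /rank_le (AB _ tB) /=; apply: IH.
rewrite /column /= onth_default //=.
suff -> : pmap (fun row => onth row t) T = [::] by [].
elim: T B pB tB {IH BA AB} => //= C T IH B /andP[/(dominatesP i0)[CB _] pC] tB.
by rewrite onth_default ?(IH C) //; lia.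
Qed.

Lemma standardE T : all (sorted (@rank_lt r)) T -> sorted dominates T -> standard T.
Proof.
move=> sT dT; apply/andP; split=> //; apply/allP => t.
case: T dT {sT} => [|A T] //= dT; rewrite mem_iota add0n => /= tA.
have [i0 _] : exists i : idx, true by case: A tA {dT} => // i; exists i.
rewrite /column /= (onth_some i0) //=.
exact: dominates_column.
Qed.

Definition symplectic_rows i0 T :=
  all (fun w => all (fun t => t < ind_abs (nth i0 w t)) (iota 0 (size w)))%N T.

Lemma symp_violation i0 T : ~~ symplectic_rows i0 T ->
  exists2 w, w \in T & exists2 t, (t < size w)%N & (ind_abs (nth i0 w t) <= t)%N.
Proof.
move=> /allPn[w wT /allPn[t]]; rewrite mem_iota -leqNgt => tw le; exists w => //.
by exists t.
Qed.

Lemma symp_standardE i0 T :  standard T -> 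
  symplectic_rows i0 T -> symplectic_standard T.
Proof.
move=> sT /allP aT; apply/andP; split=> //; apply/allP => t _; apply/allP => i.
rewrite /column mem_pmap => /mapP[w wT E].
have tw : (t < size w)%N by case: (ltnP t (size w)) E => // ?; rewrite onth_default.
move: E; rewrite (onth_some i0) // => -[->].
by have /allP := aT w wT; apply; rewrite mem_iota.
Qed.

Definition cells T := (\sum_(w <- T) size w)%N.
Definition tab_wt T := (\sum_(w <- T) row_wt w)%N.
Definition sq_len T := (\sum_(w <- T) size w ^ 2)%N.
Definition len_wt T := (\sum_(w <- T) size w * row_wt w)%N.
Definition sq_wt T := (\sum_(w <- T) row_wt w ^ 2)%N.

(** A lexicographic order on tableaux with a fixed number of cells: the
symplectic step raises the weight, straightening keeps it and either makes the
row lengths more unequal, or moves weight from a longer to a shorter row, or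
makes the weights of two rows of equal length more unequal. *)
Definition better T' T :=
  cells T' = cells T /\
  ((tab_wt T < tab_wt T')%N \/ tab_wt T' = tab_wt T /\
  ((sq_len T < sq_len T')%N \/ sq_len T' = sq_len T /\
  ((len_wt T' < len_wt T)%N \/ len_wt T' = len_wt T /\
   (sq_wt T < sq_wt T')%N))).

Lemma sq_sum_le (J : Type) (s : seq J) (F : J -> nat) :
  (\sum_(j <- s) F j ^ 2 <= (\sum_(j <- s) F j) ^ 2)%N.
Proof.
elim: s => [|j s IH]; first by rewrite !big_nil.
by rewrite !big_cons; nia.
Qed.

Lemma tab_wt_bound T : (tab_wt T <= cells T * r.*2.+1 ^ r.*2)%N.
Proof.
rewrite /tab_wt /cells big_distrl /=; apply: leq_sum => w _.
by apply: row_wt_le => i _; apply/ltnW/ind_rank_lt.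
Qed.

(** All four quantities are bounded in terms of the number of cells. *)
Lemma better_ind (Q : seq (seq idx) -> Prop) :
  (forall T, (forall T', better T' T -> Q T') -> Q T) -> forall T, Q T.
Proof.
move=> step.
pose D T := (cells T * r.*2.+1 ^ r.*2 - tab_wt T)%N.
pose E T := (cells T ^ 2 - sq_len T)%N.
pose G T := (tab_wt T ^ 2 - sq_wt T)%N.
have Ebnd T : (sq_len T <= cells T ^ 2)%N by apply: sq_sum_le.
have Gbnd T : (sq_wt T <= tab_wt T ^ 2)%N by apply: sq_sum_le.
move=> T; move: {2}(D T) (erefl (D T)) => d; elim/ltn_ind: d T => d IHd T.
move: {2}(E T) (erefl (E T)) => e; elim/ltn_ind: e T => e IHe T.
move: {2}(len_wt T) (erefl (len_wt T)) => l; elim/ltn_ind: l T => l IHl T.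
move: {2}(G T) (erefl (G T)) => g; elim/ltn_ind: g T => g IHg T Gg Ll Ee Dd.
apply: step => T' [cT [wlt|[weq [slt|[seq [llt|[leq glt]]]]]]].
- apply: (IHd (D T')) => //; rewrite -Dd /D cT.
  by have := tab_wt_bound T'; have := tab_wt_bound T; rewrite cT; lia.
- apply: (IHe (E T')) => //; last by rewrite -Dd /D cT weq.
  by rewrite -Ee /E cT; have := Ebnd T'; have := Ebnd T; rewrite cT; lia.
- apply: (IHl (len_wt T')) => //; first by lia.
    by rewrite -Ee /E cT seq.
  by rewrite -Dd /D cT weq.
- apply: (IHg (G T')) => //; last 3 first.
  + by rewrite -Ll.
  + by rewrite -Ee /E cT seq.
  + by rewrite -Dd /D cT weq.
  by rewrite -Gg /G weq; have := Gbnd T'; have := Gbnd T; rewrite weq; lia.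
Qed.

End Tableau.

(** * Rewriting to symplectic standard tableaux *)

Lemma sum_sq_spread k m x y : (m <= k)%N -> (x + y = k + m)%N ->
  (y < m)%N || (k < y)%N -> (k ^ 2 + m ^ 2 < x ^ 2 + y ^ 2)%N.
Proof. by move=> mk xy /orP[]; nia. Qed.

Lemma weighted_sum_shift k m a b a' b' : (m < k)%N -> (a' < a)%N ->
  (a' + b' = a + b)%N -> (k * a' + m * b' < k * a + m * b)%N.
Proof. by nia. Qed.

Lemma mem_split (T : eqType) (x : T) s : x \in s -> exists s1 s2, s = s1 ++ x :: s2.
Proof. by case/path.splitPr => s1 s2; exists s1, s2. Qed.

Section Canon.
Variable r : nat.
Notation idx := 'I_(r + r).
Implicit Types (A B w : seq idx) (T : seq (seq idx)).

(** Rows of equal length are sorted by weight, so that straightening, which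
makes the first row lighter, spreads the two weights apart. *)
Definition row_le A B :=
  ((size B < size A) || (size A == size B) && (row_wt A <= row_wt B))%N.

Definition canon T := sort row_le [seq sort (@rank_le r) w | w <- T & w != [::]].

Definition even_rows T := all (fun w => ~~ odd (size w)) T.

Lemma row_le_total : total row_le.
Proof. by move=> A B; rewrite /row_le; lia. Qed.

Lemma canon_sorted T : sorted row_le (canon T).
Proof. exact: sort_sorted row_le_total _. Qed.

Lemma canon_mem T w : w \in canon T ->
  exists2 w', w' \in T & w' != [::] /\ w = sort (@rank_le r) w'.
Proof.
rewrite mem_sort => /mapP[w' ]; rewrite mem_filter => /andP[w0 wT] ->.
by exists w'.
Qed.

Lemma canon_sum T (f : seq idx -> nat) : f [::] = 0%N ->
  (forall w w', perm_eq w w' -> f w = f w') ->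
  (\sum_(w <- canon T) f w = \sum_(w <- T) f w)%N.
Proof.
move=> f0 fp; rewrite /canon (perm_big _ (permEl (perm_sort _ _))) /= big_map big_filter.
rewrite big_mkcond; apply: eq_bigr => w _; case: eqP => [->//|_] /=.
by apply: fp; rewrite perm_sort.
Qed.

Lemma better_canon T' T : better T' (canon T) -> better T' T.
Proof.
rewrite /better /cells /tab_wt /sq_len /len_wt /sq_wt !canon_sum //.
all: try (by rewrite /row_wt ?big_nil ?muln0).
all: try by move=> w w' p; rewrite ?(row_wt_perm p) ?(perm_size p).
Qed.

Lemma canon_even T : even_rows T -> even_rows (canon T).
Proof.
by move=> /allP eT; apply/allP => w /canon_mem[w' /eT ew [_ ->]]; rewrite size_sort.
Qed.

Lemma canon_rows T : all uniq T -> all (sorted (@rank_lt r)) (canon T).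
Proof.
by move=> /allP uT; apply/allP => w /canon_mem[w' /uT uw [_ ->]]; apply: sort_rank_lt.
Qed.

Lemma canon_neq0 T w : w \in canon T -> w != [::].
Proof.
by move=> /canon_mem[w' _ [w0 ->]]; rewrite -size_eq0 size_sort size_eq0.
Qed.

End Canon.

Section Span.
Variables (R : comNzRingType) (r : nat) (y : 'I_(r + r) -> 'I_(r + r) -> R).
Notation idx := 'I_(r + r).
Implicit Types (A B w : seq idx) (T : seq (seq idx)).
Hypothesis yskew : forall i j, y i j = - y j i.
Hypothesis ydiag : forall i, y i i = 0.
Hypothesis yiso : forall x z, \sum_(q < r)
  (y (lshift r q) x * y (rshift r q) z - y (rshift r q) x * y (lshift r q) z) = 0.
Hypothesis ytr : \sum_(q < r) y (lshift r q) (rshift r q) = 0.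
Variable P : R -> Prop.
Hypothesis Pg : subgroup_pred P.
Hypothesis Pdiv : forall x j, (j <= r)%N -> P (x *+ j`!) -> P x.

Definition prod_pf T := \prod_(w <- T) pf y w.

Lemma prod_pf_canon T : exists b : bool, prod_pf T = (-1) ^+ b * prod_pf (canon T).
Proof.
rewrite /prod_pf /canon (perm_big _ (permEl (perm_sort _ _))) /= big_map.
elim: T => [|w T [b IH]] /=; first by exists false; rewrite !big_nil mul1r.
rewrite big_cons IH; case: eqP => [->|_] /=; first by exists b; rewrite pf_nil mul1r.
have [|c ->] := @pf_perm_eq _ _ y yskew w (sort (@rank_le r) w).
  by rewrite perm_sym perm_sort.
by exists (c (+) b); rewrite big_cons signr_addb; ring.
Qed.

Lemma mul_subgroup z : subgroup_pred (fun x => P (x * z)).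
Proof.
by split=> [|a b]; rewrite ?mul0r ?mulrBl; [case: Pg | apply: (proj2 Pg)].
Qed.

Lemma mul_divisible z x j : (j <= r)%N -> P (x *+ j`! * z) -> P (x * z).
Proof. by rewrite mulrnAl; apply: Pdiv. Qed.

(** Entries exchanged between the rows come from [b_1..b_t] and
[a_t..a_k], and all of the former are smaller than all of the latter. *)
Lemma straighten_rows T1 A B T2 :
  sorted (@rank_lt r) A -> sorted (@rank_lt r) B ->
  ~~ odd (size A) -> ~~ odd (size B) ->
  row_le A B -> ~~ dominates A B ->
  (forall W W', ~~ odd (size W) -> ~~ odd (size W') ->
     better (W :: W' :: T1 ++ T2) (T1 ++ A :: B :: T2) ->
     P (prod_pf (W :: W' :: T1 ++ T2))) ->
  P (prod_pf (T1 ++ A :: B :: T2)).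
Proof.
move=> sA sB oA oB AB ndom IH.
have pE W W' : prod_pf (W :: W' :: T1 ++ T2) = pf y W * pf y W' * prod_pf (T1 ++ T2).
  by rewrite /prod_pf !big_cons mulrA.
have -> : prod_pf (T1 ++ A :: B :: T2) = pf y A * pf y B * prod_pf (T1 ++ T2).
  by rewrite -pE /prod_pf !(big_cat, big_cons) /=; ring.
have BA : (size B <= size A)%N by move: AB; rewrite /row_le; lia.
have [i0 _] : exists i : idx, true.
  case E: B => [|i B']; last by exists i.
  by case/negP: ndom; rewrite E; apply/andP; split=> //; apply/forallP => -[].
(* A column where the two rows violate standardness. *)
have [t tB tv] : exists2 t, (t < size B)%N & (ind_rank (nth i0 B t) < ind_rank (nth i0 A t))%N.
  have [|none] := boolP [exists t : 'I_(size B), (ind_rank (nth i0 B t) < ind_rank (nth i0 A t))%N].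
    by move=> /existsP[t]; exists t.
  case/negP: ndom; apply/(dominatesP i0); split=> // t tB.
  by rewrite leqNgt; apply: contra none => v; apply/existsP; exists (Ordinal tB).
pose A0 := take t A; pose X := drop t A; pose Z := take t.+1 B; pose B0 := drop t.+1 B.
have pA : perm_eq A (X ++ A0) by rewrite perm_sym perm_catC cat_take_drop.
have EB : B = Z ++ B0 by rewrite cat_take_drop.
have sX : size X = (size A - t)%N by rewrite size_drop.
have sA0 : size A0 = t by rewrite size_takel //; lia.
have sZ : size Z = t.+1 by rewrite size_takel.
have [b ->] := pf_perm_eq yskew pA; rewrite -!mulrA; apply: subgroup_pred_sign => //; rewrite mulrA.
have szA : size A = size (X ++ A0) by rewrite (perm_size pA).
have szB : size B = size (Z ++ B0) by rewrite -EB.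
suff key (U V U' V' : seq idx) : perm_eq (U ++ V) X -> perm_eq (U' ++ V') Z ->
    let W := (U ++ U') ++ A0 in let W' := (V ++ V') ++ B0 in
    ~~ odd (size W') ->
    [|| (size W' < size B)%N, (size A < size W')%N |
       ((V != [::]) || (U' != [::])) && (size W == size A)] ->
    P (prod_pf (W :: W' :: T1 ++ T2)).
  rewrite {1}EB; apply: (straighten (mul_subgroup (prod_pf (T1 ++ T2)))).
  - by rewrite -szA.
  - by rewrite -szB.
  - by rewrite -szA -szB.
  - by rewrite sA0 sZ.
  - by rewrite -szA -szB => U V U' V' pX pZ W W' oW' cases; rewrite -pE; apply: key.
move=> pX pZ W W' oW' cases.
have sUV : (size U + size V = size X)%N by rewrite -size_cat (perm_size pX).
have sUV' : (size U' + size V' = size Z)%N by rewrite -size_cat (perm_size pZ).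
have sWW : (size W + size W' = size A + size B)%N.
  by rewrite /W /W' szA szB !size_cat -sUV -sUV' addnACA; clear; lia.
have wA : row_wt A = (row_wt U + row_wt V + row_wt A0)%N.
  by rewrite (row_wt_perm pA) row_wt_cat -(row_wt_perm pX) row_wt_cat.
have wB : row_wt B = (row_wt U' + row_wt V' + row_wt B0)%N.
  by rewrite EB row_wt_cat -(row_wt_perm pZ) row_wt_cat.
have wW : row_wt W = (row_wt U + row_wt U' + row_wt A0)%N by rewrite /W !row_wt_cat.
have wW' : row_wt W' = (row_wt V + row_wt V' + row_wt B0)%N by rewrite /W' !row_wt_cat.
have oW : ~~ odd (size W).
  by have := congr1 odd sWW; rewrite !oddD (negPf oA) (negPf oB) (negPf oW') addbF => ->.
have wAB : (row_wt W + row_wt W' = row_wt A + row_wt B)%N.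
  by rewrite wA wB wW wW'; clear; lia.
apply: IH => //.
have sumW f : (\sum_(w <- W :: W' :: T1 ++ T2) f w = f W + f W' + \sum_(w <- T1 ++ T2) f w)%N.
  by rewrite !big_cons addnA.
have sumA f : (\sum_(w <- T1 ++ A :: B :: T2) f w = f A + f B + \sum_(w <- T1 ++ T2) f w)%N.
  by rewrite !(big_cat, big_cons) /=; clear; lia.
rewrite /better /cells /tab_wt /sq_len /len_wt /sq_wt !sumW !sumA !ltn_add2r sWW wAB.
split=> //; right; split=> //.
have [out|inn] := boolP ((size W' < size B) || (size A < size W'))%N.
  by left; exact: sum_sq_spread.
move: cases; rewrite orbA (negPf inn) /= => /andP[ne /eqP sW].
have sW' : size W' = size B by apply/eqP; rewrite -(eqn_add2l (size A)) -sWW sW.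
right; rewrite sW sW'; split=> //.
have sVU : size V = size U'.
  move: sW; rewrite /W szA !size_cat -sUV; clear; lia.
have V0 : (0 < size V)%N.
  by case/orP: ne; rewrite -size_eq0 -lt0n ?sVU.
(* As many letters move to the first row as leave it, and they are smaller. *)
have lt : (row_wt U' < row_wt V)%N.
  pose k := ind_rank (nth i0 B t).
  have U'k : (row_wt U' <= size U' * r.*2.+1 ^ k)%N.
    apply: row_wt_le => i iU'; have : i \in Z by rewrite -(perm_mem pZ) mem_cat iU'.
    move=> /(nthP i0)[s]; rewrite sZ => st <-; rewrite nth_take //.
    have [->//|nst] := eqVneq s t.
    have st' : (s < t)%N by rewrite ltn_neqAle nst.
    apply/ltnW/(sorted_ltn_nth (@rank_lt_trans r) i0 sB) => //; rewrite inE //.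
    exact: ltn_trans st' tB.
  have Vk : (size V * r.*2.+1 ^ k.+1 <= row_wt V)%N.
    apply: row_wt_ge => i iV; have : i \in X by rewrite -(perm_mem pX) mem_cat iV orbT.
    move=> /(nthP i0)[s]; rewrite sX => st <-; rewrite nth_drop.
    apply: leq_trans tv _.
    case: s st => [|s] st; first by rewrite addn0.
    rewrite ltn_subRL in st; apply/ltnW/(sorted_ltn_nth (@rank_lt_trans r) i0 sA).
    - by rewrite inE; apply: leq_ltn_trans (leq_addr _ _) st.
    - by rewrite inE.
    - by rewrite addnS ltnS leq_addr.
  apply: leq_ltn_trans U'k _; apply: leq_trans Vk.
  rewrite sVU ltn_pmul2l -?sVU // ltn_exp2l //.
  by have := ltn_ord i0; clear; lia.
have ltA : (row_wt W < row_wt A)%N by rewrite wA wW ltn_add2r ltn_add2l.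
move: AB; rewrite /row_le => /orP[AB|/andP[/eqP AB lAB]].
  by left; apply: weighted_sum_shift.
right; split; first by rewrite AB -!mulnDr wAB.
rewrite addnC [X in (_ < X)%N]addnC; apply: sum_sq_spread => //.
  by rewrite addnC wAB addnC.
by rewrite ltA.
Qed.

Lemma symplectic_row i0 T1 w T2 t :
  sorted (@rank_lt r) w -> (t < size w)%N -> (ind_abs (nth i0 w t) <= t)%N ->
  (forall w', size w' = size w -> better (w' :: T1 ++ T2) (T1 ++ w :: T2) ->
     P (prod_pf (w' :: T1 ++ T2))) ->
  P (prod_pf (T1 ++ w :: T2)).
Proof.
move=> sw tw vt IH.
have pE v : prod_pf (v :: T1 ++ T2) = pf y v * prod_pf (T1 ++ T2) by rewrite /prod_pf big_cons.
have -> : prod_pf (T1 ++ w :: T2) = pf y w * prod_pf (T1 ++ T2).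
  by rewrite /prod_pf !(big_cat, big_cons) /= mulrCA.
apply: (symplectic_step yskew ydiag yiso ytr (mul_subgroup _) _ sw tw vt).
  by move=> x j; apply: mul_divisible.
move=> w' sw' ww'; rewrite -pE; apply: IH => //.
rewrite /better /cells /tab_wt !(big_cat, big_cons) /= sw'.
by split; [|left]; lia.
Qed.

(** Well-founded induction: a product is first brought to sorted rows, and
unless it is symplectic standard, one of the two relations applies. *)
Theorem pf_tableaux_span :
  (forall T, is_tableau T -> symplectic_standard T -> even_tableau T -> P (prod_pf T)) ->
  forall T, even_rows T -> P (prod_pf T).
Proof.
move=> Pstd; elim/better_ind => T IH eT.
case: (boolP (all uniq T)) => [uT|/allPn[w wT nuw]]; last first.
  have [s1 [s2 ->]] := mem_split wT; rewrite /prod_pf big_cat big_cons /=.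
  by rewrite (pf_not_uniq yskew ydiag nuw) mul0r mulr0; case: Pg.
have [b ->] := prod_pf_canon T; apply: subgroup_pred_sign => //.
have {}IH T' : even_rows T' -> better T' (canon T) -> P (prod_pf T').
  by move=> eT' bT'; apply: IH => //; apply: better_canon.
have srt := canon_sorted T; have rows := canon_rows uT; have ev := canon_even eT.
have ne := @canon_neq0 _ T.
move: {T eT uT b}(canon T) srt rows ev ne IH => T srt rows ev ne IH.
have in_rows s1 w s2 : T = s1 ++ w :: s2 -> sorted (@rank_lt r) w /\ ~~ odd (size w).
  by move=> E; split; [apply: (allP rows) | apply: (allP ev)]; rewrite E mem_cat mem_head orbT.
case: (boolP (sorted (@dominates r) T)) => [dom|ndom]; last first.
  have [s1 [A [B [s2 [E AB nAB]]]]] := sorted_not_sorted srt ndom.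
  have [sA oA] := in_rows _ _ _ E.
  have [|sB oB] := in_rows (rcons s1 A) B s2; first by rewrite cat_rcons.
  rewrite E; apply: straighten_rows => // W W' oW oW' bW; apply: IH; last by rewrite E.
  by move: ev; rewrite E /even_rows /= !all_cat /= oW oW' => /andP[-> /and3P[_ _ ->]].
have std := standardE rows dom.
have [[i0 _]|noidx] := pselect (exists i : idx, true); last first.
  have T0 : T = [::].
    case: T ne {srt rows ev IH in_rows dom std} => // -[|i w] T ne; last by case: noidx; exists i.
    by have := ne [::] (mem_head _ _).
  by rewrite T0; apply: Pstd.
case: (boolP (symplectic_rows i0 T)) => [sym|nsym].
  apply: Pstd.
  - apply/andP; split.
      rewrite /shape sorted_map; apply: sub_sorted dom => A B /andP[] //.
    apply/mapP => -[w /ne w0 /esym/eqP]; by rewrite size_eq0 (negPf w0).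
  - exact: symp_standardE std sym.
  - by rewrite /even_tableau all_map.
have [w wT [t tw vt]] := symp_violation nsym.
have [s1 [s2 E]] := mem_split wT; rewrite E in in_rows IH ev *.
have [sw ow] := in_rows _ _ _ erefl.
apply: (symplectic_row sw tw vt) => w' sw' bw; apply: IH => //.
by move: ev; rewrite /even_rows /= !all_cat /= sw' ow => /andP[-> ->].
Qed.

End Span.

(** * The pfaffian as a signed sum over permutations *)

Section PfDef.
Variables (R : comNzRingType) (I : Type) (M : I -> I -> R).

Lemma der_enum (v : I -> R) f m (h : 'I_m.+1 -> I) :
  der v f [seq h a | a <- enum 'I_m.+1] =
  \sum_(j < m.+1) (-1) ^+ j * (v (h j) * f [seq h (lift j a) | a <- enum 'I_m]).
Proof.
elim: m f h => [|m IH] f h.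
  by rewrite enum_ordSl enum_ord0 big_ord1 /= subr0 mul1r.
rewrite enum_ordSl /= big_ord_recl /= mul1r -map_comp; congr (_ + _).
rewrite (IH _ (h \o lift ord0)) -sumrN; apply: eq_bigr => j _.
rewrite /= exprS !mulN1r mulNr; congr (- (_ * (_ * f _))).
rewrite [in RHS]enum_ordSl /= -map_comp; congr (h _ :: _); first exact: val_inj.
apply: eq_map => a /=; congr h; apply: val_inj => /=.
by rewrite /bump /=; lia.
Qed.

(** The position of 0 can neither be the second one of a pair nor the first
one of a later pair. *)
Lemma pf_perm0 m (s : 'S_m.+2) : ~~ odd m -> pf_perm s -> s ord0 = ord0.
Proof.
move=> om /andP[/forallP p1 /forallP p2].
pose x := (s^-1)%g ord0; have sx : s x = ord0 by rewrite permKV.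
have ltx : (x./2 < m.+2./2)%N by have := ltn_ord x; lia.
have := p1 (Ordinal ltx).
have [xo|xe] := boolP (odd x).
  have -> : pf_snd (Ordinal ltx) = x by apply: val_inj => /=; lia.
  by rewrite sx.
have E : pf_fst (Ordinal ltx) = x by apply: val_inj => /=; lia.
have [x0 _|x0] := eqVneq x ord0; first by rewrite -{1}x0.
have /forallP/(_ (Ordinal ltx)) := p2 ord0; rewrite /= E sx implybF => /negP[].
have : (0 < x)%N by rewrite lt0n -val_eqE in x0 *.
by lia.
Qed.

Lemma lift_perm_inj n (i j : 'I_n.+1) : injective (lift_perm i j).
Proof.
move=> s t st; apply/permP => k; apply: (@lift_inj _ j).
by rewrite -!(lift_perm_lift i) st.
Qed.

Lemma lift_perm_surj n (i j : 'I_n.+1) (s : 'S_n.+1) : s i = j ->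
  exists t, s = lift_perm i j t.
Proof.
move=> sij; pose f k := odflt k (unlift j (s (lift i k))).
have fK k : lift j (f k) = s (lift i k).
  rewrite /f; case: unliftP => //= /eqP; rewrite -{1}sij (inj_eq perm_inj).
  by rewrite eq_sym (negPf (neq_lift _ _)).
have finj : injective f.
  by move=> k l /(congr1 (lift j)); rewrite !fK => /perm_inj/lift_inj.
exists (perm finj); apply/permP => k.
by case: (unliftP i k) => [l|] ->; rewrite ?lift_perm_id ?lift_perm_lift ?permE ?fK.
Qed.

Lemma sum_lift_perm n (i j : 'I_n.+1) (Q : pred 'S_n.+1) (F : 'S_n.+1 -> R) :
  \sum_(s | Q s && (s i == j)) F s =
  \sum_(t | Q (lift_perm i j t)) F (lift_perm i j t).
Proof.
rewrite (reindex (lift_perm i j)).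
  by apply: eq_bigl => t; rewrite lift_perm_id eqxx andbT.
exists (fun s => odflt 1%g [pick t | s == lift_perm i j t]) => [t _|s].
  by case: pickP => [u /eqP/lift_perm_inj //|/(_ t)]; rewrite eqxx.
rewrite inE => /andP[_ /eqP/lift_perm_surj[t ->]].
by case: pickP => [u /eqP ->|/(_ t)]; rewrite ?eqxx.
Qed.

Lemma ltn_lift n (i : 'I_n.+1) (a b : 'I_n) : (lift i a < lift i b)%N = (a < b)%N.
Proof. by rewrite /= /bump; lia. Qed.

Lemma pf_fst_lift m (i : 'I_m./2) (i' : 'I_m.+2./2) : i' = i.+1 :> nat ->
  pf_fst i' = lift ord0 (lift ord0 (pf_fst i)).
Proof. by move=> E; apply: val_inj; rewrite /= /bump E; lia. Qed.
Lemma pf_snd_lift m (i : 'I_m./2) (i' : 'I_m.+2./2) : i' = i.+1 :> nat ->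
  pf_snd i' = lift ord0 (lift ord0 (pf_snd i)).
Proof. by move=> E; apply: val_inj; rewrite /= /bump E; lia. Qed.

(** The first pair is (0, j + 1), which meets all the constraints, and lifting
is increasing. *)
Lemma pf_perm_lift m (j : 'I_m.+1) (s : 'S_m) :
  pf_perm (lift_perm ord0 ord0 (lift_perm ord0 j s)) = pf_perm s.
Proof.
set t := lift_perm _ _ _.
have tl (k : 'I_m) : t (lift ord0 (lift ord0 k)) = lift ord0 (lift j (s k)).
  by rewrite !lift_perm_lift.
have t0 (i : 'I_m.+2./2) : i = 0 :> nat -> t (pf_fst i) = ord0.
  move=> E; rewrite (_ : pf_fst i = ord0) ?lift_perm_id //.
  by apply: val_inj; rewrite /= E.
have lift_half (i : 'I_m./2) : (i.+1 < m.+2./2)%N by have := ltn_ord i; lia.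
have pred_half (i : 'I_m.+2./2) : (0 < i)%N -> (i.-1 < m./2)%N.
  by have := ltn_ord i; lia.
apply/andP/andP => -[/forallP p1 /forallP p2]; split; apply/forallP => i.
- have := p1 (Ordinal (lift_half i)).
  by rewrite (pf_fst_lift (i := i)) ?(pf_snd_lift (i := i)) // !tl !ltn_lift.
- apply/forallP => k; apply/implyP => ik.
  have /forallP/(_ (Ordinal (lift_half k))) := p2 (Ordinal (lift_half i)).
  by rewrite (pf_fst_lift (i := i)) ?(pf_fst_lift (i := k)) // !tl !ltn_lift /= ltnS ik.
- have [i0|i0] := posnP i.
    rewrite t0 // (_ : pf_snd i = lift ord0 ord0) ?lift_perm_lift ?lift_perm_id //.
    by apply: val_inj; rewrite /= /bump i0.
  have E : i = (Ordinal (pred_half i i0)).+1 :> nat by rewrite /= prednK.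
  by rewrite (pf_fst_lift E) (pf_snd_lift E) !tl !ltn_lift p1.
- apply/forallP => k; apply/implyP => ik.
  have k0 : (0 < k)%N by apply: leq_ltn_trans ik.
  have Ek : k = (Ordinal (pred_half k k0)).+1 :> nat by rewrite /= prednK.
  rewrite (pf_fst_lift Ek) tl.
  have [i0|i0] := posnP i; first by rewrite t0.
  have E : i = (Ordinal (pred_half i i0)).+1 :> nat by rewrite /= prednK.
  rewrite (pf_fst_lift E) tl !ltn_lift.
  have /forallP/(_ (Ordinal (pred_half k k0))) := p2 (Ordinal (pred_half i i0)).
  by move/implyP; apply; rewrite /= -ltnS !prednK.
Qed.

Lemma pfaffian_expand m (A : 'M[R]_m.+2) : ~~ odd m ->
  pfaffian A = \sum_(j < m.+1) (-1) ^+ j * (A ord0 (lift ord0 j) *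
     pfaffian (\matrix_(a, b) A (lift ord0 (lift j a)) (lift ord0 (lift j b)))).
Proof.
move=> om; rewrite /pfaffian.
transitivity (\sum_(s : 'S_m.+2 | pf_perm s && (s ord0 == ord0))
    (-1) ^+ s * \prod_(i < m.+2./2) A (s (pf_fst i)) (s (pf_snd i))).
  apply: eq_bigl => s; case p: (pf_perm s) => //=.
  by rewrite (pf_perm0 om p) eqxx.
rewrite sum_lift_perm (partition_big (fun s : 'S_m.+1 => s ord0) predT) //=.
apply: eq_bigr => j _; rewrite sum_lift_perm mulrA big_distrr /=.
apply: eq_big => [s|s _]; first exact: pf_perm_lift.
rewrite !odd_lift_perm /= signr_addb signr_odd -!mulrA; congr (_ * _).
rewrite mulrCA; congr (_ * _).
rewrite big_ord_recl; congr (_ * _).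
  rewrite (_ : pf_fst _ = ord0) ?lift_perm_id; last exact: val_inj.
  rewrite (_ : pf_snd _ = lift ord0 ord0) ?lift_perm_lift ?lift_perm_id //.
  exact: val_inj.
apply: eq_bigr => i _; rewrite !mxE (pf_fst_lift (i := i)) ?(pf_snd_lift (i := i)) //.
by rewrite !lift_perm_lift.
Qed.

Lemma pfaffian_pf m (g : 'I_m -> I) : ~~ odd m ->
  pfaffian (\matrix_(a, b) M (g a) (g b)) = pf M [seq g a | a <- enum 'I_m].
Proof.
elim/ltn_ind: m g => -[|[|m]] IH g //= om.
  rewrite enum_ord0 /= /pfaffian (bigD1 1%g) /=; last by apply/andP; split; apply/forallP => -[].
  rewrite odd_perm1 big_ord0 mul1r big1 ?addr0 // => s /andP[_ /eqP[]].
  by apply/permP => -[].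
rewrite negbK in om; rewrite pfaffian_expand // enum_ordSl /= pf_cons -map_comp der_enum.
apply: eq_bigr => j _; rewrite mxE; congr (_ * (_ * _)).
rewrite -(IH m _ (fun a => g (lift ord0 (lift j a)))) //.
by congr pfaffian; apply/matrixP => a b; rewrite !mxE.
Qed.
End PfDef.

(** * Weights and leading monomials *)

Import Num.Theory Order.TTheory.

Section FormPlus.
Variables (R : comNzRingType) (I : Type).
Implicit Types (u v : I -> R) (Z : I -> I -> R).

Definition plus_wedge Z u v c x := Z c x + (u c * v x - v c * u x).

(** The exponential of Z + u v is that of Z times 1 + u v, as the square of
the 2-form u v vanishes. *)
Lemma pf_plus_wedge Z u v w :
  pf (plus_wedge Z u v) w = pf Z w + der u (der v (pf Z)) w.
Proof.
move: {2}(size w) (leqnn (size w)) => n; elim: n w => [|n IH] [|c w] // sw; try by rewrite /= addr0.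
rewrite der2_cons !pf_cons.
pose G w := pf Z w + der u (der v (pf Z)) w.
rewrite (@der_ext _ _ _ _ G); last first.
  by move=> X sX; apply: IH; rewrite -ltnS (leq_trans _ sw) //= sX.
have dG a : der a G w = der a (pf Z) w + der a (der u (der v (pf Z))) w by rewrite derD.
have dv : der v G w = der v (pf Z) w.
  by rewrite dG der_anti [der u _ w]der0 ?oppr0 ?addr0 // => X _; rewrite der_sq.
have du : der u G w = der u (pf Z) w by rewrite dG der_sq addr0.
rewrite /plus_wedge der_add.
rewrite (@eq_der _ _ (fun x => u c * v x - v c * u x)
  (fun x => u c * v x + (- v c) * u x)); last by move=> x; ring.
rewrite der_add !der_scale dv du dG.
rewrite [der (Z c) (der u _) w]der_anti.
rewrite (@der_ext _ _ _ (der (Z c) (der v (pf Z)))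
  (fun X => - der v (der (Z c) (pf Z)) X)); last first.
  by move=> X _; rewrite der_anti.
rewrite derN opprK.
rewrite [in RHS](@der_ext _ _ u (fun X => der v _ X) (der v (der (Z c) (pf Z)))); last first.
  by move=> X _; apply: der_ext => Y _; rewrite pf_cons.
by ring.
Qed.

Lemma pf_form0 w : pf (fun _ _ : I => 0 : R) w = (if w is [::] then 1 else 0).
Proof.
case: w => // c w; rewrite pf_cons.
by elim: w (pf _) => //= x w IH f; rewrite IH; ring.
Qed.

Variable col : nat -> I -> R.

(** The 2-form spanned by the pairs of columns (2i, 2i + 1), j <= i < j + k. *)
Fixpoint wedge_form j k : I -> I -> R :=
  if k is k'.+1 then plus_wedge (wedge_form j.+1 k') (col j.*2) (col j.*2.+1)
  else fun _ _ => 0.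
End FormPlus.

Section Weight.
Variables (N : nat) (R : comNzRingType) (wv : 'I_N -> int).
Implicit Types (f g : {mpoly R[N]}) (m : 'X_{1..N}) (B C : int).

(** Weights may be negative; only their additivity is used, so any choice of
integer weights can play the role of a monomial order. *)
Definition wdeg m : int := \sum_k wv k * (m k)%:Z.

Lemma wdegD m m' : wdeg (m + m') = wdeg m + wdeg m'.
Proof. by rewrite -big_split; apply: eq_bigr => k _; rewrite mnmDE PoszD mulrDr. Qed.

Lemma wdeg0 : wdeg 0%MM = 0.
Proof. by apply: big1 => k _; rewrite mnm0E mulr0. Qed.

Lemma wdegU k : wdeg U_(k) = wv k.
Proof.
rewrite /wdeg (bigD1 k) //= mnm1E eqxx mulr1 big1 ?addr0 // => l lk.
by rewrite mnm1E eq_sym (negPf lk) mulr0.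
Qed.

Definition wle f B := forall m, m \in msupp f -> wdeg m <= B.

Lemma wle_trans f B C : wle f B -> B <= C -> wle f C.
Proof. by move=> fB BC m /fB; lia. Qed.

Lemma wle0 B : wle 0 B.
Proof. by move=> m; rewrite msupp0. Qed.

Lemma wleD f g B : wle f B -> wle g B -> wle (f + g) B.
Proof. by move=> fB gB m /msuppD_le; rewrite mem_cat => /orP[/fB|/gB]. Qed.

Lemma wleN f B : wle f B -> wle (- f) B.
Proof. by move=> fB m; rewrite (perm_mem (msuppN f)); apply: fB. Qed.

Lemma wleB f g B : wle f B -> wle g B -> wle (f - g) B.
Proof. by move=> fB gB; apply: wleD => //; apply: wleN. Qed.

Lemma wleM f g B C : wle f B -> wle g C -> wle (f * g) (B + C).
Proof.
move=> fB gC m /msuppM_le /allpairsP[[m1 m2] /= [/fB le1 /gC le2 ->]].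
by rewrite wdegD; lia.
Qed.

Lemma wleX m : wle 'X_[m] (wdeg m).
Proof. by move=> m'; rewrite msuppX inE => /eqP ->. Qed.

Lemma wle1 : wle 1 0.
Proof. by move=> m; rewrite msupp1 inE => /eqP ->; rewrite wdeg0. Qed.

Lemma wle_sum (J : Type) (s : seq J) (p : pred J) (F : J -> {mpoly R[N]}) B :
  (forall j, p j -> wle (F j) B) -> wle (\sum_(j <- s | p j) F j) B.
Proof. by move=> FB; apply: (big_ind (wle^~ B)) => //; [exact: wle0 | move=> f g; exact: wleD]. Qed.

(** The coefficient of the leading monomial is a sign, so that it does not
depend on the field. *)
Definition has_lead f m := exists b : bool, wle (f - (-1) ^+ b * 'X_[m]) (wdeg m - 1).

Lemma wle_sign (b : bool) f B : wle f B -> wle ((-1) ^+ b * f) B.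
Proof. by case: b; rewrite ?mulN1r ?mul1r //; apply: wleN. Qed.

Lemma lead_wle f m : has_lead f m -> wle f (wdeg m).
Proof.
case=> b h; rewrite -[f](subrK ((-1) ^+ b * 'X_[m])); apply: wleD.
  by apply: wle_trans h _; lia.
by apply: wle_sign; apply: wleX.
Qed.

Lemma lead1 : has_lead 1 0%MM.
Proof. by exists false; rewrite mul1r mpolyX0 subrr; apply: wle0. Qed.

Lemma leadX m : has_lead 'X_[m] m.
Proof. by exists false; rewrite mul1r subrr; apply: wle0. Qed.

Lemma leadM f g m m' : has_lead f m -> has_lead g m' -> has_lead (f * g) (m + m').
Proof.
move=> lf lg; have := lead_wle lf; have := lead_wle lg.
case: lf => b hf; case: lg => c hg wg wf; exists (b (+) c).
rewrite mpolyXD signr_addb wdegD.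
rewrite (_ : _ - _ = f * (g - (-1) ^+ c * 'X_[m'])
   + (f - (-1) ^+ b * 'X_[m]) * ((-1) ^+ c * 'X_[m'])); last by ring.
apply: wleD; first by apply: (wle_trans (wleM wf hg)); lia.
apply: (@wle_trans _ (wdeg m - 1 + wdeg m')); last by lia.
by apply: wleM hf _; apply: wle_sign; exact: wleX.
Qed.

Lemma leadD f g m : has_lead f m -> wle g (wdeg m - 1) -> has_lead (f + g) m.
Proof. by case=> b h hg; exists b; rewrite addrAC; apply: wleD. Qed.

Lemma lead_coeff f m : has_lead f m -> exists b : bool, f@_m = (-1) ^+ b.
Proof.
case=> b h; exists b; rewrite -[f](subrK ((-1) ^+ b * 'X_[m])) mcoeffD.
rewrite memN_msupp_eq0 ?add0r; last by apply/negP => /h; lia.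
by case: b {h}; rewrite ?mulN1r ?mul1r ?mcoeffN mcoeffX eqxx.
Qed.

Lemma lead_coeff0 f m m' : has_lead f m -> m' != m -> wdeg m <= wdeg m' -> f@_m' = 0.
Proof.
case=> b h mm' le; rewrite -[f](subrK ((-1) ^+ b * 'X_[m])) mcoeffD.
rewrite memN_msupp_eq0 ?add0r; last by apply/negP => /h; lia.
by case: b {h}; rewrite ?mulN1r ?mul1r ?mcoeffN mcoeffX eq_sym (negPf mm') ?oppr0.
Qed.
End Weight.

(** * Leading monomials of pfaffians *)

Section Diagonal.
Variables (r N : nat) (R : comNzRingType) (wv : 'I_N -> int).
Notation idx := 'I_(r + r).
Notation D := {mpoly R[N]}.
Implicit Types (i x : idx) (X w : seq idx) (t c : nat).

(** Both factors decrease, along the columns and along the order of the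
entries, so the rearrangement inequality makes the diagonal of a row the
heaviest choice. *)
Definition colw t : int := (r - t)%N%:Z.
Definition roww i : int := (r.*2 - ind_rank i)%N%:Z.

Lemma roww_gt0 i : 0 < roww i.
Proof. by rewrite /roww; have := ind_rank_lt i; lia. Qed.

Lemma roww_lt x i : rank_lt x i -> roww i < roww x.
Proof. by rewrite /roww /rank_lt; have := ind_rank_lt i; lia. Qed.

Fixpoint diag_weight c X : int :=
  if X is x :: X' then colw c * roww x + diag_weight c.+1 X' else 0.

Lemma diag_weight_mono c X : diag_weight c.+1 X <= diag_weight c X.
Proof.
elim: X c => //= x X IH c; have := IH c.+1; have := roww_gt0 x.
have : colw c.+1 <= colw c by rewrite /colw; lia.
by nia.
Qed.

(** The rearrangement inequality, one column at a time: taking the letter for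
column [c] from further right shifts the earlier letters by one column.  The
slack [B] absorbs the difference between the factors of two columns. *)
Lemma der_weight c v (f : seq idx -> D) X B C :
  sorted (@rank_lt r) X ->
  (forall x, x \in X -> wle wv (v x) (colw c * roww x + B)) ->
  (forall Z, sorted (@rank_lt r) Z -> subseq Z X -> (size Z).+1 = size X ->
     wle wv (f Z) (diag_weight c.+1 Z + C)) ->
  wle wv (der v f X) (diag_weight c X + B + C).
Proof.
elim: X c f B C => [|x X IH] c f B C sX vX fX /=; first exact: wle0.
have sX' : sorted (@rank_lt r) X := path_sorted sX.
have bc : colw c.+1 <= colw c by rewrite /colw; lia.
apply: wleB.
  apply: wle_trans (wleM (vX _ (mem_head _ _)) (fX X _ _ _)) _ => //.
    exact: subseq_cons.
  by lia.
apply: (@wle_trans _ _ _ _ (diag_weight c.+1 X + (B + (colw c - colw c.+1) * roww x)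
   + (C + colw c.+1 * roww x))); last by lia.
apply: IH => //.
  move=> z zX; apply: wle_trans (vX z _) _; first by rewrite inE zX orbT.
  have xz : rank_lt x z by have := order_path_min (@rank_lt_trans r) sX => /allP/(_ z zX).
  by have := roww_lt xz; nia.
move=> Z sZ ZX sz; apply: wle_trans (fX (x :: Z) _ _ _) _.
- by apply: (subseq_sorted (@rank_lt_trans r)) sX; rewrite /= eqxx.
- by rewrite /= eqxx.
- by rewrite /= sz.
- by rewrite /=; lia.
Qed.

(** Taking a letter other than the first for column [c] loses at least one,
as the column factors decrease strictly up to [r]. *)
Lemma der_lead c v (f : seq idx -> D) x X m m' :
  (c < r)%N -> sorted (@rank_lt r) (x :: X) ->
  (forall z, z \in X -> wle wv (v z) (colw c * roww z)) ->
  (forall Z, sorted (@rank_lt r) Z -> wle wv (f Z) (diag_weight c.+1 Z)) ->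
  has_lead wv (v x) m -> wdeg wv m = colw c * roww x ->
  has_lead wv (f X) m' -> wdeg wv m' = diag_weight c.+1 X ->
  has_lead wv (der v f (x :: X)) (m + m').
Proof.
move=> cr sX vX fX lv mx lf mX /=; apply: leadD; first exact: leadM.
apply: wleN; rewrite wdegD mx mX.
have bc : colw c.+1 < colw c by rewrite /colw; lia.
apply: (@wle_trans _ _ _ _ (diag_weight c.+1 X + ((colw c - colw c.+1) * roww x - 1)
   + (colw c.+1 * roww x))); last by lia.
apply: der_weight; first exact: path_sorted sX.
  move=> z zX; apply: wle_trans (vX z zX) _.
  have xz : rank_lt x z by have := order_path_min (@rank_lt_trans r) sX => /allP/(_ z zX).
  by have := roww_lt xz; nia.
move=> Z sZ ZX sz; apply: wle_trans (fX (x :: Z) _) _; last by rewrite /=; lia.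
by apply: (subseq_sorted (@rank_lt_trans r)) sX; rewrite /= eqxx.
Qed.

Variables (col : nat -> idx -> D) (mono : nat -> idx -> 'X_{1..N}).
Hypothesis col_wle : forall t i, (t < r)%N -> wle wv (col t i) (colw t * roww i).
Hypothesis col_lead : forall t i, (t < ind_abs i)%N -> has_lead wv (col t i) (mono t i).
Hypothesis mono_weight : forall t i, (t < ind_abs i)%N ->
  wdeg wv (mono t i) = colw t * roww i.

Fixpoint diag_mono c X : 'X_{1..N} :=
  if X is x :: X' then (mono c x + diag_mono c.+1 X')%MM else 0%MM.

Fixpoint admissible c X : bool :=
  if X is x :: X' then (c < ind_abs x)%N && admissible c.+1 X' else true.

Lemma diag_mono_weight c X : admissible c X -> wdeg wv (diag_mono c X) = diag_weight c X.
Proof.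
elim: X c => [|x X IH] c /=; first by rewrite wdeg0.
by move=> /andP[cx aX]; rewrite wdegD mono_weight // IH.
Qed.

Lemma pf_form_wle j k X : ((j + k).*2 <= r)%N -> sorted (@rank_lt r) X ->
  wle wv (pf (wedge_form col j k) X) (diag_weight j.*2 X).
Proof.
elim: k j X => [|k IH] j X jk sX.
  by rewrite pf_form0; case: X {sX} => [|x X]; [exact: wle1 | exact: wle0].
rewrite pf_plus_wedge.
have IH' Z : sorted (@rank_lt r) Z -> wle wv (pf (wedge_form col j.+1 k) Z) (diag_weight j.+1.*2 Z).
  by apply: IH; lia.
apply: wleD.
  apply: wle_trans (IH' X sX) _; rewrite doubleS.
  by apply: le_trans (diag_weight_mono _ _) (diag_weight_mono _ _).
rewrite -[diag_weight _ _]addr0 -[diag_weight _ _]addr0.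
apply: der_weight => //; first by move=> x _; rewrite addr0; apply: col_wle; lia.
move=> Z sZ _ _; rewrite -[diag_weight _ Z]addr0.
apply: der_weight => //; first by move=> x _; rewrite addr0; apply: col_wle; lia.
by move=> Y sY _ _; rewrite addr0 -doubleS; apply: IH'.
Qed.

Lemma ind_abs_le i : (ind_abs i <= r)%N.
Proof. by rewrite ind_absE; have := ind_rank_lt i; lia. Qed.

(** The first two columns must meet the first two letters; leaving them out
moves all letters to lighter columns. *)
Lemma pf_form_lead j k X : (j + k = r./2)%N -> sorted (@rank_lt r) X -> ~~ odd (size X) ->
  admissible j.*2 X -> has_lead wv (pf (wedge_form col j k) X) (diag_mono j.*2 X).
Proof.
elim: k j X => [|k IH] j [|x [|y X]] // jk sX oX aX; try exact: lead1.
  move: aX => /and3P[_ ay _]; have := ind_abs_le y; lia.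
have /and3P[ax ay aX'] := aX.
rewrite pf_plus_wedge.
have sY : sorted (@rank_lt r) (y :: X) := path_sorted sX.
have sX' : sorted (@rank_lt r) X := path_sorted sY.
have y_r := ind_abs_le y.
have jr : (j.*2.+1 < r)%N by lia.
have wF Z : sorted (@rank_lt r) Z -> wle wv (pf (wedge_form col j.+1 k) Z) (diag_weight j.*2.+2 Z).
  by rewrite -doubleS; apply: pf_form_wle; lia.
have lF : has_lead wv (pf (wedge_form col j.+1 k) X) (diag_mono j.*2.+2 X).
  by rewrite -doubleS; apply: IH; rewrite ?doubleS //; [lia | move: oX; rewrite /= negbK].
have wG Z : sorted (@rank_lt r) Z ->
    wle wv (der (col j.*2.+1) (pf (wedge_form col j.+1 k)) Z) (diag_weight j.*2.+1 Z).
  move=> sZ; rewrite -[diag_weight _ _]addr0 -[diag_weight _ _]addr0.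
  apply: der_weight => //; first by move=> z _; rewrite addr0; apply: col_wle; lia.
  by move=> Y sY' _ _; rewrite addr0; apply: wF.
rewrite addrC; apply: leadD.
  apply: (@der_lead j.*2) => //; first by lia.
  - by move=> z _; apply: col_wle; lia.
  - exact: col_lead.
  - exact: mono_weight.
  - apply: (@der_lead j.*2.+1) => //.
    + by move=> z _; apply: col_wle; lia.
    + exact: col_lead.
    + exact: mono_weight.
    + exact: diag_mono_weight.
  by apply: (@diag_mono_weight _ (y :: X)); rewrite /= ay.
rewrite diag_mono_weight //; apply: wle_trans (wF _ sX) _.
rewrite /=.
have b1 : colw j.*2.+2 + 2 <= colw j.*2 by rewrite /colw; lia.
have b2 : colw j.*2.+3 <= colw j.*2.+1 by rewrite /colw; lia.
have := roww_gt0 x; have := roww_gt0 y.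
have := diag_weight_mono j.*2.+2 X; have := diag_weight_mono j.*2.+3 X.
by nia.
Qed.

End Diagonal.

(** * Isotropic forms *)

Lemma pf_morph (R S : comNzRingType) (h : {rmorphism R -> S}) (I : Type)
  (M : I -> I -> R) w : h (pf M w) = pf (fun i j => h (M i j)) w.
Proof.
have hder v f X : h (der v f X) = der (fun x => h (v x)) (fun Z => h (f Z)) X.
  by elim: X f => /= [|x X IH] f; rewrite ?rmorph0 // rmorphB rmorphM IH.
move: {2}(size w) (leqnn (size w)) => n; elim: n w => [|n IH] [|x w] //= sw; try exact: rmorph1.
rewrite !pf_cons hder; apply: der_ext => Z sZ; apply: IH.
by rewrite -ltnS (leq_trans _ sw) //= sZ.
Qed.

(** The product of det (X - M) and det (X + M) is a power of X. *)
Lemma char_poly_sq0 (R : idomainType) n (M : 'M[R]_n) : M *m M = 0 -> char_poly M = 'X^n.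
Proof.
move=> M2.
have E : char_poly M * char_poly (- M) = 'X^(n.*2).
  rewrite /char_poly -det_mulmx /char_poly_mx map_mxN opprK.
  have M2' : map_mx polyC M *m map_mx polyC M = 0 by rewrite -map_mxM M2 map_mx0.
  rewrite mulmxDr !mulmxBl M2' subr0 [map_mx _ _ *m _]scalar_mxC subrK.
  by rewrite -scalar_mxM det_scalar -expr2 -exprM mul2n.
have /dvdp_exp_XsubCP[k _] : char_poly M %| ('X - 0%:P) ^+ n.*2.
  by rewrite subr0 -E dvdp_mulr.
rewrite subr0 eqp_monic ?char_poly_monic ?monicXn // => /eqP E'.
by rewrite E'; congr 'X^_; have := size_char_poly M; rewrite E' size_polyXn => -[].
Qed.

Lemma mul_J_form (R : comNzRingType) r (A B : 'M[R]_(r + r)) i j :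
  (A^T *m Jmx r R *m B) i j =
  \sum_(q < r) (A (lshift r q) i * B (rshift r q) j - A (rshift r q) i * B (lshift r q) j).
Proof.
rewrite -{1}[A]vsubmxK -{1}[B]vsubmxK tr_col_mx /Jmx mul_row_block mul_row_col.
rewrite !mulmx0 !mulmx1 mulmxN mulmx1 add0r addr0 addrC mxE !mxE -big_split.
by apply: eq_bigr => q _; rewrite !mxE mulNr.
Qed.

Section Isotropic.
Variables (R : comNzRingType) (r : nat).
Notation idx := 'I_(r + r).
Implicit Types (f g : idx -> R).

Definition sform f g : R :=
  \sum_(q < r) (f (lshift r q) * g (rshift r q) - f (rshift r q) * g (lshift r q)).

Lemma sform_anti f g : sform f g = - sform g f.
Proof. by rewrite -sumrN; apply: eq_bigr => q _; ring. Qed.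

(** Three summands, as needed for one step of [wedge_form]. *)
Lemma sform_lin a b c f g1 g2 g3 :
  (forall i, f i = a * g1 i + b * g2 i + c * g3 i) ->
  forall h, sform f h = a * sform g1 h + b * sform g2 h + c * sform g3 h.
Proof.
move=> E h; rewrite !mulr_sumr -!big_split; apply: eq_bigr => q _ /=.
by rewrite !E; ring.
Qed.

Variable col : nat -> idx -> R.
Hypothesis col_iso : forall s t, sform (col s) (col t) = 0.

Lemma wedge_form_skew j k x z : wedge_form col j k x z = - wedge_form col j k z x.
Proof.
by elim: k j => [|k IH] j /=; rewrite ?oppr0 // /plus_wedge IH; ring.
Qed.

Lemma wedge_form_diag j k x : wedge_form col j k x x = 0.
Proof.
by elim: k j => [|k IH] j //=; rewrite /plus_wedge IH; ring.
Qed.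

Lemma wedge_form_iso f j k z : (forall t, sform (col t) f = 0) ->
  sform (fun i => wedge_form col j k i z) f = 0.
Proof.
move=> cf; elim: k j => [|k IH] j /=.
  by rewrite /sform big1 // => q _; rewrite !mul0r subr0.
rewrite (@sform_lin 1 (col j.*2.+1 z) (- col j.*2 z) _
   (fun i => wedge_form col j.+1 k i z) (col j.*2) (col j.*2.+1)).
  by rewrite IH !cf !mulr0 !addr0.
by move=> i; rewrite /plus_wedge; ring.
Qed.

Lemma wedge_form_iso2 j k x z :
  sform (fun i => wedge_form col j k i x) (fun i => wedge_form col j k i z) = 0.
Proof.
apply: wedge_form_iso => t; rewrite sform_anti wedge_form_iso ?oppr0 // => ?; exact: col_iso.
Qed.
End Isotropic.

(** * A generic point of the scheme *)

Section Point.
Variables (r : nat) (F : fieldType).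
Notation idx := 'I_(r + r).
Notation D := {mpoly F[(r + r) * r]}.
Implicit Types (i : idx) (q t : 'I_r).

(** The variable for row [i] and column [t]; the one with [i] the barred copy
of [t] is used to scale column [t]. *)
Definition var i t : 'I_((r + r) * r) := mxvec_index i t.

(** The scaling variable carries the weight of the diagonal entry of its
column, which is then subtracted from all other variables of the column. *)
Definition var_wt (k : 'I_((r + r) * r)) : int :=
  mxvec (\matrix_(i < r + r, t < r)
     if i == rshift r t then colw r t * roww i
     else colw r t * (roww i - roww (rshift r t))) 0 k.

Lemma var_wtE i t : var_wt (var i t) =
  if i == rshift r t then colw r t * roww i
     else colw r t * (roww i - roww (rshift r t)).
Proof. by rewrite /var_wt mxvecE mxE. Qed.

Definition lowmx : 'M[D]_r :=
  \matrix_(q, t) if q == t then 1 else if (t < q)%N then 'X_(var (rshift r q) t) else 0.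
Definition symmx : 'M[D]_r :=
  \matrix_(q, t) if (t <= q)%N then 'X_(var (lshift r q) t) else 'X_(var (lshift r t) q).
(** The inverse of [lowmx] is its adjugate. *)
Definition isomx : 'M[D]_(r + r, r) := col_mx ((\adj lowmx)^T *m symmx) lowmx.

Lemma det_lowmx : \det lowmx = 1.
Proof.
rewrite det_trig; first by rewrite big1 // => q _; rewrite mxE eqxx.
apply/is_trig_mxP => q t qt; rewrite mxE -val_eqE /=.
by case: eqP => [|_]; [lia | case: ltnP => //; lia].
Qed.

Lemma adj_lowmx : \adj lowmx *m lowmx = 1%:M.
Proof. by rewrite mul_adj_mx det_lowmx. Qed.

Lemma symmx_tr : symmx^T = symmx.
Proof.
apply/matrixP => q t; rewrite !mxE.
by case: (ltngtP q t) => // /val_inj ->.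
Qed.

(** With U the inverse of L, the form of the columns of [U^T S ; L] is
S^T U L - L^T U^T S, that is S^T - S. *)
Lemma isomx_iso s t : sform (isomx^~ s) (isomx^~ t) = 0.
Proof.
rewrite /sform.
have := @mul_J_form D r.
transitivity ((((\adj lowmx)^T *m symmx)^T *m lowmx) s t
   - (lowmx^T *m ((\adj lowmx)^T *m symmx)) s t).
  rewrite !mxE -sumrB; apply: eq_bigr => q _.
  by rewrite /isomx !col_mxEu !col_mxEd !mxE.
rewrite trmx_mul trmxK symmx_tr -mulmxA adj_lowmx mulmx1.
by rewrite mulmxA -trmx_mul adj_lowmx trmx1 mul1mx subrr.
Qed.

Notation le f B := (wle var_wt f B).

Lemma roww_lshift q : roww (lshift r q) = (r.*2 - q.*2.+1)%N%:Z.
Proof. by rewrite /roww rank_lshift. Qed.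
Lemma roww_rshift q : roww (rshift r q) = (r.*2 - q.*2)%N%:Z.
Proof. by rewrite /roww rank_rshift. Qed.

Definition roww_shiftE := (roww_lshift, roww_rshift).

Lemma varX_wle i t : i != rshift r t ->
  le ('X_(var i t) : D) (colw r t * (roww i - roww (rshift r t))).
Proof.
by move=> it; apply: wle_trans (@wleX _ _ _ _) _; rewrite wdegU var_wtE (negPf it).
Qed.

Lemma lowmx_wle q t : le (lowmx q t) (colw r t * (roww (rshift r q) - roww (rshift r t))).
Proof.
rewrite mxE; case: eqP => [->|qt]; first by rewrite subrr mulr0; apply: wle1.
case: ltnP => tq; last exact: wle0.
by apply: varX_wle; rewrite eq_rshift; apply/eqP.
Qed.

Lemma lowmx_wle0 q t : le (lowmx q t) 0.
Proof.
case: (leqP t q) => tq.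
  apply: wle_trans (@lowmx_wle q t) _; rewrite !roww_shiftE /colw.
  have := ltn_ord q; nia.
rewrite mxE -val_eqE /=; case: eqP => [|_]; first by lia.
by case: ltnP => [|_]; [lia | exact: wle0].
Qed.

Lemma symmx_wle q t : (t <= q)%N ->
  le (symmx q t) (colw r t * (roww (lshift r q) - roww (rshift r t))).
Proof. by move=> tq; rewrite mxE tq; apply: varX_wle; rewrite eq_lrshift. Qed.

Lemma symmx_wle0 q t : le (symmx q t) 0.
Proof.
wlog tq : q t / (t <= q)%N.
  move=> h; case: (leqP t q) => [/h //|/ltnW/h].
  by rewrite -{1}symmx_tr mxE.
apply: wle_trans (symmx_wle tq) _; rewrite !roww_shiftE /colw.
have := ltn_ord q; nia.
Qed.

(** Solving U L = 1 column by column from the right. *)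
Lemma adj_lowmx_spec t q : [/\ le ((\adj lowmx) q t) 0,
   (q < t)%N -> (\adj lowmx) q t = 0 & q = t -> (\adj lowmx) q t = 1].
Proof.
move: {2}(r - t)%N (leqnn (r - t)) => n; elim: n t q => [|n IH] t q tn.
  by have := ltn_ord t; lia.
have := congr1 (fun M : 'M_r => M q t) adj_lowmx; rewrite [LHS]mxE [RHS]mxE (bigD1 t) //=.
rewrite [lowmx t t]mxE eqxx mulr1 => E.
have hq (p : 'I_r) : p != t -> [/\ le ((\adj lowmx) q p * lowmx p t) 0 &
     (q <= t)%N -> (\adj lowmx) q p * lowmx p t = 0].
  move=> pt; case: (ltnP t p) => tp.
    have [|h1 h2 _] := IH p q; first by have := ltn_ord p; lia.
    split; first by rewrite -[0]addr0; apply: wleM h1 (@lowmx_wle0 _ _).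
    by move=> qt; rewrite h2 ?mul0r //; lia.
  have -> : lowmx p t = 0 by rewrite mxE (negPf pt) ltnNge tp.
  by rewrite mulr0; split=> //; apply: wle0.
have {}E : (\adj lowmx) q t = (q == t)%:R - \sum_(p | p != t) (\adj lowmx) q p * lowmx p t.
  by rewrite -E addrK.
split.
- rewrite E; apply: wleB; last by apply: wle_sum => p /hq[].
  by case: (q == t); [exact: wle1 | exact: wle0].
- move=> qt; rewrite E big1 => [|p /hq[_]]; last by apply; lia.
  by rewrite -val_eqE /= ltn_eqF // subr0.
- move=> qt; rewrite E big1 => [|p /hq[_]]; last by apply; rewrite qt.
  by rewrite qt eqxx subr0.
Qed.

(** Above the diagonal the bound is nonnegative while all entries of U and S
have weight at most zero; below it, the factors of U beyond the diagonal can
only pick lighter entries of S. *)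
Lemma topmx_wle q t :
  le (((\adj lowmx)^T *m symmx) q t) (colw r t * (roww (lshift r q) - roww (rshift r t))).
Proof.
rewrite mxE; apply: wle_sum => p _; rewrite mxE.
have [h1 h2 _] := adj_lowmx_spec q p.
case: (ltnP q t) => qt.
  apply: wle_trans (wleM h1 (@symmx_wle0 p t)) _; rewrite !roww_shiftE /colw.
  have := ltn_ord t; nia.
case: (ltnP p q) => pq; first by rewrite h2 // mul0r; apply: wle0.
apply: wle_trans (wleM h1 (symmx_wle (leq_trans qt pq))) _; rewrite !roww_shiftE /colw.
have := ltn_ord p; nia.
Qed.

Lemma topmx_lead q t : (t <= q)%N ->
  has_lead var_wt (((\adj lowmx)^T *m symmx) q t) U_(var (lshift r q) t).
Proof.
move=> tq; rewrite mxE (bigD1 q) //= mxE; have [_ _ ->//] := adj_lowmx_spec q q.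
rewrite mul1r; apply: leadD; first by rewrite mxE tq; apply: leadX.
rewrite wdegU var_wtE eq_lrshift; apply: wle_sum => p pq; rewrite mxE.
have [h1 h2 _] := adj_lowmx_spec q p.
case: (ltnP p q) => lpq; first by rewrite h2 // mul0r; apply: wle0.
apply: wle_trans (wleM h1 (symmx_wle (leq_trans tq lpq))) _; rewrite !roww_shiftE /colw.
have : (q < p)%N by rewrite ltn_neqAle lpq andbT eq_sym.
have := ltn_ord p; nia.
Qed.

Definition iso_col (c : nat) i : D :=
  if insub c is Some t then 'X_(var (rshift r t) t) * isomx i t else 0.

Definition entry_mono (c : nat) i : 'X_{1..(r + r) * r} :=
  if insub c is Some t then
    (U_(var (rshift r t) t) + (if i == rshift r t then 0 else U_(var i t)))%MM
  else 0%MM.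

Lemma col_iso a b : sform (iso_col a) (iso_col b) = 0.
Proof.
rewrite /iso_col; case: (insub a : option 'I_r) => [s|]; last first.
  by rewrite /sform big1 // => q _; rewrite !mul0r subrr.
case: (insub b : option 'I_r) => [t|]; last first.
  by rewrite /sform big1 // => q _; rewrite !mulr0 subrr.
transitivity ('X_(var (rshift r s) s) * 'X_(var (rshift r t) t) *
   sform (isomx^~ s) (isomx^~ t)); last by rewrite isomx_iso mulr0.
by rewrite /sform mulr_sumr; apply: eq_bigr => q _; ring.
Qed.

Lemma mono_weight c i : (c < ind_abs i)%N -> wdeg var_wt (entry_mono c i) = colw r c * roww i.
Proof.
move=> ci; rewrite /entry_mono; have cr : (c < r)%N := leq_trans ci (ind_abs_le i).
rewrite insubT /= wdegD wdegU var_wtE eqxx; case: eqP => [->|ne].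
  by rewrite wdeg0 addr0.
by rewrite wdegU var_wtE; case: eqP => // _; rewrite /=; ring.
Qed.

Lemma col_wle c i : (c < r)%N -> le (iso_col c i) (colw r c * roww i).
Proof.
move=> cr; rewrite /iso_col insubT /=; set t := Sub _ _.
rewrite (_ : colw r c * roww i = colw r t * roww (rshift r t) +
   colw r t * (roww i - roww (rshift r t))); last by rewrite /=; ring.
apply: wleM.
  by apply: wle_trans (@wleX _ _ _ _) _; rewrite wdegU var_wtE eqxx.
rewrite /isomx -(splitK i); case: (split i) => q /=; rewrite ?col_mxEu ?col_mxEd.
  exact: topmx_wle.
exact: lowmx_wle.
Qed.

Lemma col_lead c i : (c < ind_abs i)%N -> has_lead var_wt (iso_col c i) (entry_mono c i).
Proof.
move=> ci; have cr : (c < r)%N := leq_trans ci (ind_abs_le i).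
rewrite /iso_col /entry_mono insubT /=; set t := Sub _ _; apply: leadM; first exact: leadX.
move: ci; rewrite ind_absE -(splitK i); case: (split i) => q /=.
  rewrite rank_lshift /= uphalf_double eq_lrshift => cq.
  by rewrite /isomx col_mxEu; apply: topmx_lead.
rewrite rank_rshift doubleK eq_rshift /isomx col_mxEd mxE => cq.
case: eqP => [_|ne]; first exact: lead1.
rewrite (_ : (t < q)%N = true); first exact: leadX.
by rewrite ltn_neqAle -ltnS cq andbT; apply/eqP => E; apply: ne; apply: val_inj.
Qed.

Definition point := wedge_form iso_col 0 r./2.

Lemma point_lead X : sorted (@rank_lt r) X -> ~~ odd (size X) -> admissible 0 X ->
  has_lead var_wt (pf point X) (diag_mono entry_mono 0 X).
Proof. by move=> *; apply: (pf_form_lead col_wle col_lead mono_weight (j := 0)). Qed.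

End Point.

(** * Spanning in the coordinate ring *)

Section PairSpan.
Variables (F : fieldType) (M : lmodType F) (I : choiceType) (v : I -> M).

(** Lists of pairs make closure properties immediate, as repetitions are
allowed. *)
Definition in_span (x : M) := exists l : seq (F * I), x = \sum_(p <- l) p.1 *: v p.2.

Lemma in_span_subgroup : subgroup_pred in_span.
Proof.
split=> [|x y [l ->] [l' ->]]; first by exists [::]; rewrite big_nil.
exists (l ++ [seq (- p.1, p.2) | p <- l']); rewrite big_cat big_map /= -sumrN.
by congr (_ + _); apply: eq_bigr => p _; rewrite scaleNr.
Qed.

Lemma in_spanZ a x : in_span x -> in_span (a *: x).
Proof.
case=> l ->; exists [seq (a * p.1, p.2) | p <- l]; rewrite big_map scaler_sumr.
by apply: eq_bigr => p _; rewrite scalerA.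
Qed.

Lemma in_span_gen i : in_span (v i).
Proof. by exists [:: (1, i)]; rewrite big_seq1 scale1r. Qed.

Lemma spanning_in_span : (forall x, in_span x) -> spanning v.
Proof.
move=> sp x; have [l ->] := sp x.
exists (undup (unzip2 l)), (fun i => \sum_(p <- l | p.2 == i) p.1).
under [RHS]eq_bigr do rewrite scaler_suml big_mkcond.
rewrite exchange_big /= big_seq [RHS]big_seq; apply: eq_bigr => p pl.
rewrite (bigD1_seq p.2) ?undup_uniq ?mem_undup ?map_f //= eqxx big1 ?addr0 //.
by move=> i /negPf ip; rewrite eq_sym ip.
Qed.
End PairSpan.

Lemma small_natr_neq0 (F : fieldType) r :
  ([pchar F]%R =i pred0) \/ (exists2 p : nat, p \in [pchar F]%R & (r < p)%N) ->
  forall k, (0 < k <= r)%N -> k%:R != 0 :> F.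
Proof.
move=> [/pcharf0P h|[p pF rp]] k /andP[k0 kr]; first by rewrite h -lt0n.
by rewrite -(dvdn_pcharf pF); apply/negP => /(dvdn_leq k0); lia.
Qed.

Section CoordRing.
Variables (r : nat) (F : fieldType).
Notation idx := 'I_(r + r).
Notation A := (coord_ring r F).

Lemma V_class_eq0 p : V_class p = 0 :> A <-> ideal_gen (@V_equation r F) p.
Proof.
rewrite -(rmorph0 (@V_class r F)).
split=> [/eqP|h]; rewrite /V_class.
  by rewrite -Quotient.idealrBE subr0 => /asboolP.
by apply/eqP; rewrite -Quotient.idealrBE subr0; apply/asboolP.
Qed.

Lemma V_equation_class p : V_equation p -> V_class p = 0 :> A.
Proof.
move=> Vp; apply/V_class_eq0; exists [:: (1, p)]; split.
  by move=> c; rewrite inE => /eqP ->.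
by rewrite big_seq1 mul1r.
Qed.

Definition yV (i j : idx) : A := V_class (genY r F i j).

Lemma yV_skew i j : yV i j = - yV j i.
Proof.
have := V_equation_class (V_skew F i j); rewrite mxE [X in _ + X]mxE rmorphD.
by move/eqP; rewrite addr_eq0 => /eqP.
Qed.

Lemma yV_diag i : yV i i = 0.
Proof. exact: V_equation_class (V_diag F i). Qed.

Lemma yV_iso x z : \sum_(q < r)
  (yV (lshift r q) x * yV (rshift r q) z - yV (rshift r q) x * yV (lshift r q) z) = 0.
Proof.
have := V_equation_class (V_isotropic F x z); rewrite mul_J_form raddf_sum => E; rewrite -[RHS]E.
by apply: eq_bigr => q _; rewrite /= rmorphB !rmorphM.
Qed.

Lemma tr_mul_J (R : comNzRingType) (B : 'M[R]_(r + r)) :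
  \tr (Jmx r R *m B) = \sum_(q < r) (B (rshift r q) (lshift r q) - B (lshift r q) (rshift r q)).
Proof.
have JB : Jmx r R *m B = col_mx (dsubmx B) (- usubmx B).
  rewrite -{1}[B]vsubmxK /Jmx mul_block_col !mul0mx mulNmx !mul1mx add0r addr0.
  by [].
rewrite JB /mxtrace big_split_ord /= -big_split /=; apply: eq_bigr => q _.
by rewrite col_mxEu col_mxEd !mxE.
Qed.

(** The trace of JY is a coefficient of the characteristic polynomial, and by
skew symmetry it is, up to sign, twice this sum. *)
Lemma yV_tr : (0 < r)%N -> (2%:R : F) != 0 -> \sum_(q < r) yV (lshift r q) (rshift r q) = 0.
Proof.
move=> r0 two.
have := V_equation_class (@V_char_poly r F (r + r).-1).
rewrite coefB char_poly_trace ?addn_gt0 ?r0 // coefXn.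
rewrite (_ : (_ == _) = false) ?subr0; last by apply/negbTE; lia.
rewrite [\tr _]raddfN /= opprK tr_mul_J raddf_sum /=.
set S := \sum_(q < r) yV _ _ => E.
have {}E : 2%:R *: S = 0 :> A.
  apply/eqP; rewrite -oppr_eq0; apply/eqP; rewrite -[RHS]E scaler_nat mulr2n -big_split -sumrN.
  apply: eq_bigr => q _ /=; rewrite rmorphB.
  suff: - (yV (lshift r q) (rshift r q) + yV (lshift r q) (rshift r q))
    = yV (rshift r q) (lshift r q) - yV (lshift r q) (rshift r q) by [].
  by rewrite [yV (rshift r q) _]yV_skew opprD.
by move/(congr1 (fun z => 2%:R^-1 *: z)): E; rewrite scalerA mulVf // scale1r scaler0.
Qed.

Notation gen := (fun T : symp_even_tableau r => pf_tableau F (sval T)).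

Lemma pf_row_pf w : ~~ odd (size w) -> pf_row F w = pf (genY r F) w.
Proof.
move=> ow; rewrite /pf_row (pfaffian_pf (genY r F) _ ow).
by rewrite map_tnth_enum.
Qed.

Lemma pf_tableau_prod T : even_tableau T -> pf_tableau F T = prod_pf yV T.
Proof.
rewrite /even_tableau all_map => /allP eT.
rewrite /pf_tableau rmorph_prod /prod_pf big_seq [RHS]big_seq; apply: eq_bigr => w wT.
by rewrite pf_row_pf ?pf_morph //; apply: eT.
Qed.

Lemma V_classZ c p : V_class (c *: p) = c *: V_class p :> A.
Proof. by rewrite -mul_mpolyC rmorphM. Qed.

Lemma monomial_prod_pf m : exists2 T, even_rows T & V_class 'X_[m] = prod_pf yV T :> A.
Proof.
pose K (x : A) := exists2 T, even_rows T & x = prod_pf yV T.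
have K1 : K 1 by exists [::]; rewrite ?/prod_pf ?big_nil.
have KM x z : K x -> K z -> K (x * z).
  move=> [T eT ->] [T' eT' ->]; exists (T ++ T'); first by rewrite /even_rows all_cat; apply/andP.
  by rewrite /prod_pf big_cat.
have KX (k : 'I_((r + r) * (r + r))) : K (V_class 'X_k).
  case/mxvec_indexP: k => i j; exists [:: [:: i; j]] => //.
  rewrite /prod_pf big_seq1 pf_cons /= subr0 mulr1 /yV mxE.
  by [].
rewrite mpolyXE_id rmorph_prod; apply: (big_ind K) => // k _; rewrite rmorphXn.
elim: (m k) => [|e IH]; first by rewrite expr0; apply: K1.
by rewrite exprS; apply: KM IH; apply: KX.
Qed.

Lemma pf_tableaux_spanning :  (0 < r)%N ->
  (forall k, (0 < k <= r)%N -> k%:R != 0 :> F) -> (2%:R : F) != 0 -> spanning gen.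
Proof.
move=> r0 nat0 two; apply: spanning_in_span => x.
have Pg := in_span_subgroup gen.
rewrite -[x]reprK -/(V_class _); elim/mpolyind: (repr x) => [|c m p _ _ IH].
  by rewrite rmorph0; case: Pg.
rewrite rmorphD; apply: (subgroup_predD Pg) => //.
change (in_span gen (V_class (c *: 'X_[m]) : A)).
rewrite V_classZ; apply: in_spanZ; have [T eT ->] := monomial_prod_pf m.
apply: (pf_tableaux_span yV_skew yV_diag yV_iso (yV_tr r0 two) Pg) => //.
  move=> z j jr; rewrite -scaler_nat => /(in_spanZ (j`!%:R)^-1).
  rewrite scalerA mulVf ?scale1r //.
  elim: j jr => [|j IHj] jr; first by rewrite oner_eq0.
  by rewrite factS natrM; apply: mulf_neq0; [apply: nat0 | apply/IHj/ltnW].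
move=> T1 tT sT eT'; rewrite -pf_tableau_prod //.
have pT : [&& is_tableau T1, symplectic_standard T1 & even_tableau T1] by rewrite tT sT.
exact: (in_span_gen gen (exist _ T1 pT)).
Qed.

End CoordRing.

(** * Leading monomials determine tableaux *)

Section TableauMonomial.
Variable r : nat.
Notation idx := 'I_(r + r).
Implicit Types (w : seq idx) (T : seq (seq idx)).
Notation entry_mono := (@entry_mono r).

Definition tab_mono T := (\sum_(w <- T) diag_mono entry_mono 0 w)%MM.

Lemma var_eq (i j : idx) (s t : 'I_r) : (var i s == var j t) = (i == j) && (s == t).
Proof.
rewrite /var /mxvec_index (inj_eq (@cast_ord_inj _ _ _)) (inj_eq enum_rank_inj).
by rewrite xpair_eqE.
Qed.

(** The exponent of the variable for [i] and [t] counts these entries of column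
[t]: all of them for the scaling variable, and the entries [i] otherwise. *)
Definition hits (t : 'I_r) (i x : idx) := (i == rshift r t) || (x == i).

Lemma mono_var c (i x : idx) (t : 'I_r) :
  entry_mono c x (var i t) = ((c == t) && hits t i x)%N :> nat.
Proof.
rewrite /entry_mono /hits; case: insubP => [s _ <-|cr]; last first.
  rewrite mnm0E; case: eqP => // ct; move: cr; rewrite ct ltn_ord //.
rewrite mnmDE mnm1E var_eq andbC (_ : (s == t :> nat) = (s == t)) //.
case: (eqVneq s t) => [->|st] /=; last first.
  by case: eqP; rewrite ?mnm0E // mnm1E var_eq (negPf st) andbF.
rewrite [_ == i]eq_sym; case: (eqVneq i (rshift r t)) => [->|it].
  case: (eqVneq x (rshift r t)) => [_|ne]; first by rewrite mnm0E.
  by rewrite mnm1E var_eq (negPf ne).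
case: (eqVneq x (rshift r t)) => [->|_]; first by rewrite mnm0E eq_sym (negPf it).
by rewrite mnm1E var_eq eqxx andbT.
Qed.

Lemma diag_mono_var c w i (t : 'I_r) :
  diag_mono entry_mono c w (var i t) =
  (if (c <= t)%N then oapp (fun x => hits t i x : nat) 0%N (onth w (t - c)) else 0%N) :> nat.
Proof.
elim: w c => [|x w IH] c /=; first by rewrite mnm0E onth0n; case: ifP.
rewrite mnmDE mono_var IH; case: ltngtP => [ct|ct|->] /=.
- by rewrite subnS; case: (t - c)%N (subn_gt0 c t) => [|k]; rewrite ?ct.
- by [].
- by rewrite subnn addn0.
Qed.

Lemma tab_mono_var T i (t : 'I_r) : tab_mono T (var i t) = count (hits t i) (column T t).
Proof.
rewrite /tab_mono; elim: T => [|w T IH]; first by rewrite big_nil mnm0E.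
rewrite big_cons mnmDE IH diag_mono_var subn0 /= /column /=.
by case: (onth w t) => [x|].
Qed.

(** The multiplicity of the barred copy of [t] is the only one that is not
seen directly; it follows from the length of the column. *)
Lemma perm_hits (t : 'I_r) (s1 s2 : seq idx) :
  (forall i, count (hits t i) s1 = count (hits t i) s2) -> perm_eq s1 s2.
Proof.
move=> h; pose b := rshift r t.
have hb s : count (hits t b) s = size s.
  by rewrite -count_predT; apply: eq_count => x; rewrite /hits eqxx.
have hi i s : i != b -> count (hits t i) s = count_mem i s.
  by move=> ib; apply: eq_count => x; rewrite /hits (negPf ib).
have pf : perm_eq (filter (predC1 b) s1) (filter (predC1 b) s2).
  apply/allP => x _ /=; apply/eqP; rewrite !count_filter.
  have [->|xb] := eqVneq x b.
    by rewrite !(eq_count (a2 := pred0)) ?count_pred0 // => z /=; case: eqP.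
  have E : predI (pred1 x) (predC1 b) =1 pred1 x.
    by move=> z /=; case: eqP => // ->.
  by rewrite !(eq_count E) -!hi // h.
have hs : size s1 = size s2 by rewrite -!hb h.
apply/allP => x _ /=; apply/eqP; have [->|xb] := eqVneq x b; last by rewrite -!hi // h.
have := perm_size pf; rewrite !size_filter => E.
have := count_predC (pred1 b) s1; have := count_predC (pred1 b) s2.
rewrite -[count (predC (pred1 b)) s1]/(count (predC1 b) s1) E hs => <-.
exact: addIn.
Qed.

Lemma column_nil T t : (width T <= t)%N -> is_tableau T -> column T t = [::].
Proof.
case: T => [|w T] // wt /andP[p _]; have {}p : path geq (size w) (shape T) := p.
have : all (fun v => size v <= t)%N (w :: T).
  apply/andP; split=> //; have := order_path_min _ p => /(_ (fun a b c ab bc => leq_trans bc ab)).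
  rewrite all_map; apply: sub_all => v /= vw; exact: leq_trans vw wt.
elim: (w :: T) => [|v s IH] // /andP[vt vs].
by rewrite /column /= onth_default //=; apply: IH.
Qed.

Lemma is_tableau_behead w T : is_tableau (w :: T) -> is_tableau T.
Proof. by rewrite /is_tableau /= inE negb_or => /andP[/path_sorted -> /andP[_ ->]]. Qed.

Lemma is_tableau_head w T : is_tableau (w :: T) -> w != [::].
Proof. by case: w => // /andP[_]; rewrite inE. Qed.

Lemma column_cons w T t : is_tableau (w :: T) ->
  column (w :: T) t = if onth w t is Some x then x :: column T t else [::].
Proof.
move=> tT; case E : (onth w t) => [x|]; first by rewrite /column /= E.
by apply: column_nil tT; rewrite /width /= -onthNE E.
Qed.

(** Entry [t] of the first row is the head of column [t], and the tails are
the columns of the remaining rows. *)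
Lemma column_inj T T' : is_tableau T -> is_tableau T' ->
  (forall t, column T t = column T' t) -> T = T'.
Proof.
elim: T T' => [|w T IH] [|w' T'] tT tT' // E.
- by case: w' tT' E (is_tableau_head tT') => [|x w'] //= _ /(_ 0%N).
- by case: w tT E (is_tableau_head tT) => [|x w] //= _ /(_ 0%N).
have E' t : onth w t = onth w' t /\ (onth w t -> column T t = column T' t).
  have := E t; rewrite !column_cons //.
  by case: (onth w t) => [x|]; case: (onth w' t) => [x'|] //; case=> -> ->.
have ww' : w = w' by apply: eq_from_onth => t; case: (E' t).
subst w'; congr (_ :: _); apply: IH (is_tableau_behead tT) (is_tableau_behead tT') _ => t.
 case: (ltnP t (size w)) => tw.
  by apply: (E' t).2; rewrite onthTE.
have wd v : is_tableau (w :: v) -> (width v <= t)%N.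
  case: v => //= v s /andP[/= /andP[vw _] _]; exact: leq_trans vw tw.
by rewrite !column_nil ?wd ?(is_tableau_behead tT) ?(is_tableau_behead tT').
Qed.

Lemma width_ge T w : is_tableau T -> w \in T -> (size w <= width T)%N.
Proof.
case: T => //= v T /andP[/= p _]; rewrite inE => /orP[/eqP ->//|wT].
have := order_path_min _ p => /(_ (fun a b c ab bc => leq_trans bc ab)) /allP.
by apply; apply: map_f.
Qed.

Lemma symp_standard_entry T w : is_tableau T -> symplectic_standard T -> w \in T ->
  forall i0 t, (t < size w)%N -> (t < ind_abs (nth i0 w t))%N.
Proof.
move=> tT /andP[_ /allP sT] wT i0 t tw.
have ti : t \in iota 0 (width T) by rewrite mem_iota /= (leq_trans tw (width_ge tT wT)).
have /allP := sT t ti; apply; rewrite /column mem_pmap; apply/mapP; exists w => //.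
by rewrite (onth_some i0).
Qed.

Lemma admissible_row c w : (forall i0 t, (t < size w)%N -> (c + t < ind_abs (nth i0 w t))%N) ->
  admissible c w.
Proof.
elim: w c => //= x w IH c h; have := h x 0%N; rewrite addn0 => -> //=.
by apply: IH => i0 t tw; rewrite addSnnS; apply: (h i0 t.+1).
Qed.

Lemma column_sorted T t : is_tableau T -> symplectic_standard T ->
  sorted (@rank_le r) (column T t).
Proof.
move=> tT /andP[/andP[_ /allP cT] _]; case: (ltnP t (width T)) => wt.
  by apply: cT; rewrite mem_iota.
by rewrite column_nil.
Qed.

Lemma column_large T t : is_tableau T -> symplectic_standard T -> (r <= t)%N ->
  column T t = [::].
Proof.
move=> tT sT rt; apply: column_nil => //.
case: T tT sT => //= w T tT sT; rewrite leqNgt; apply/negP => tw.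
have [i0 _] : exists i : idx, true by case: w tw {tT sT} => // i; exists i.
have := symp_standard_entry tT sT (mem_head _ _) i0 tw.
by have := ind_abs_le (nth i0 w t); lia.
Qed.

Lemma tab_mono_inj T T' : is_tableau T -> is_tableau T' ->
  symplectic_standard T -> symplectic_standard T' ->
  tab_mono T = tab_mono T' -> T = T'.
Proof.
move=> tT tT' sT sT' E; apply: column_inj => // t.
case: (ltnP t r) => tr; last by rewrite !column_large.
apply: (@sorted_eq _ (@rank_le r)); try exact: column_sorted.
- by move=> j i k; apply: leq_trans.
- by move=> i j; rewrite /rank_le -eqn_leq => /eqP/ind_rank_inj.
by apply: (@perm_hits (Ordinal tr)) => i; rewrite -!tab_mono_var E.
Qed.

End TableauMonomial.

(** * Evaluation at the generic point and the basis theorem *)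

Section Evaluation.
Variables (r : nat) (F : fieldType).
Notation idx := 'I_(r + r).
Notation D := {mpoly F[(r + r) * r]}.
Notation cpoly := {mpoly F[(r + r) * (r + r)]}.

Definition pointmx : 'M[D]_(r + r) := \matrix_(i, j) point F i j.

Definition at_point : {rmorphism cpoly -> D} :=
  mmap (@mpolyC ((r + r) * r) F) (fun k => mxvec pointmx 0 k).

Lemma at_pointX i j : at_point (genY r F i j) = point F i j.
Proof. by rewrite mxE /at_point /= mmapX mmap1U mxvecE mxE. Qed.

Lemma at_pointC c : at_point c%:MP = c%:MP.
Proof. by rewrite /at_point /= mmapC. Qed.

Lemma map_genY : map_mx at_point (genY r F) = pointmx.
Proof. by apply/matrixP => i j; rewrite mxE at_pointX mxE. Qed.

Lemma map_Jmx (R S : comNzRingType) (h : {rmorphism R -> S}) : map_mx h (Jmx r R) = Jmx r S.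
Proof. by rewrite /Jmx map_block_mx map_mxN map_mx1 !map_mx0. Qed.

Lemma pointmx_iso : pointmx^T *m Jmx r D *m pointmx = 0.
Proof.
apply/matrixP => i j; rewrite mul_J_form [RHS]mxE.
rewrite -[RHS](wedge_form_iso2 (@col_iso r F) 0 r./2 i j).
by apply: eq_bigr => q _; rewrite !mxE.
Qed.

Lemma pointmx_tr : pointmx^T = - pointmx.
Proof. by apply/matrixP => i j; rewrite !mxE [LHS]wedge_form_skew. Qed.

(** The square of JY is J (Y J Y) = 0, so its characteristic polynomial is a
power of X over the domain of polynomials. *)
Lemma V_equation_at_point p : V_equation p -> at_point p = 0.
Proof.
case=> {p} [i j|i|i j|k].
- by rewrite mxE [X in _ + X]mxE rmorphD /= !at_pointX [X in X + _]wedge_form_skew addNr.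
- by rewrite at_pointX; apply: wedge_form_diag.
- have := congr1 (fun M : 'M[D]_(r + r) => M i j) pointmx_iso.
  rewrite -map_genY -(map_Jmx at_point) map_trmx -!map_mxM [RHS]mxE [LHS]mxE.
  by [].
rewrite -coef_map rmorphB /= map_char_poly map_polyXn map_mxN map_mxM map_Jmx map_genY.
rewrite char_poly_sq0 ?subrr ?coef0 // mulmxN mulNmx opprK -mulmxA.
rewrite [pointmx *m _]mulmxA -[X in X *m _ *m _]opprK -pointmx_tr !mulNmx pointmx_iso.
by rewrite oppr0 mulmx0.
Qed.

Lemma at_point_class0 p : V_class p = 0 :> coord_ring r F -> at_point p = 0.
Proof.
move=> /V_class_eq0[cs [csV ->]]; rewrite raddf_sum big1_seq // => c /andP[_ ccs].
by rewrite /= rmorphM /= (V_equation_at_point (csV c ccs)) mulr0.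
Qed.

Lemma tableau_lead T : is_tableau T -> symplectic_standard T -> even_tableau T ->
  has_lead (@var_wt r) (at_point (\prod_(w <- T) pf_row F w)) (tab_mono T).
Proof.
move=> tT sT eT; rewrite rmorph_prod /tab_mono.
have h w : w \in T -> has_lead (@var_wt r) (at_point (pf_row F w)) (diag_mono (@entry_mono r) 0 w).
  move=> wT; have ow : ~~ odd (size w).
    by move: eT; rewrite /even_tableau all_map => /allP/(_ w wT).
  rewrite pf_row_pf // pf_morph.
  have -> : pf (fun i j => at_point (genY r F i j)) w = pf (point F) w.
    congr (pf _ w); apply: funext => i; apply: funext => j; exact: at_pointX.
  apply: point_lead => //.
    by case/andP: sT => /andP[/allP rowsT _] _; exact: (rowsT w wT).
  by apply: admissible_row => i0 t tw; apply: (symp_standard_entry tT sT wT).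
elim: T h {tT sT eT} => [|w T IH] h; first by rewrite !big_nil; apply: lead1.
rewrite !big_cons; apply: leadM; first by apply: h; rewrite mem_head.
by apply: IH => v vT; apply: h; rewrite inE vT orbT.
Qed.

Lemma seq_argmax (J : eqType) (f : J -> int) (s : seq J) : s != [::] ->
  exists2 j, j \in s & forall i, i \in s -> f i <= f j.
Proof.
elim: s => // j s IH _; case: (eqVneq s [::]) => [->|/IH[k ks kmax]].
  by exists j; rewrite ?mem_head // => i; rewrite inE => /eqP ->.
case: (leP (f j) (f k)) => jk.
  by exists k => [|i]; rewrite inE ?ks ?orbT // => /orP[/eqP ->|/kmax].
exists j => [|i]; rewrite inE ?eqxx // => /orP[/eqP ->//|/kmax ik].
by apply: le_trans ik (ltW jk).
Qed.

(** In a vanishing combination, consider a tableau of maximal leading weight: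
its leading monomial cannot occur in any other term. *)
Lemma pf_tableaux_independent :
  lin_indep (fun T : symp_even_tableau r => pf_tableau F (sval T)).
Proof.
move=> s c us sum0 T0 T0s; apply/eqP; apply: contraT => cT0.
pose f (T : symp_even_tableau r) := at_point (\prod_(w <- sval T) pf_row F w).
pose m (T : symp_even_tableau r) := tab_mono (sval T).
have spec (T : symp_even_tableau r) :
    [/\ is_tableau (sval T), symplectic_standard (sval T) & even_tableau (sval T)].
  by case: T => T pT; apply/and3P.
have fm T : has_lead (@var_wt r) (f T) (m T) by have [tT sT eT] := spec T; apply: tableau_lead.
have m_inj : injective m.
  move=> T T' E; have [tT sT _] := spec T; have [tT' sT' _] := spec T'.
  by apply: val_inj; apply: tab_mono_inj E.
have fsum : \sum_(T <- s) (c T)%:MP * f T = 0.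
  have := at_point_class0 (p := \sum_(T <- s) (c T)%:MP * \prod_(w <- sval T) pf_row F w).
  rewrite raddf_sum => h; rewrite -[RHS]h; last first.
    by rewrite -[RHS]sum0; apply: eq_bigr => T _; rewrite /= rmorphM.
  by rewrite raddf_sum; apply: eq_bigr => T _; rewrite /= rmorphM /= at_pointC.
have ne : [seq T <- s | c T != 0] != [::].
  apply/eqP => E; have : T0 \in [seq T <- s | c T != 0] by rewrite mem_filter cT0.
  by rewrite E.
have [T1] := seq_argmax (fun T => wdeg (@var_wt r) (m T)) ne.
rewrite mem_filter => /andP[cT1 T1s] T1max.
have := congr1 (mcoeff (m T1)) fsum; rewrite mcoeff0 raddf_sum (bigD1_seq T1) //=.
rewrite mcoeffCM big1_seq ?addr0; last first.
  move=> T /andP[TT1 Ts]; rewrite mcoeffCM.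
  have [->|cT] := eqVneq (c T) 0; first by rewrite mul0r.
  rewrite (lead_coeff0 (fm T)) ?mulr0 ?(inj_eq m_inj) 1?eq_sym //.
  by apply: T1max; rewrite mem_filter cT.
have [b ->] := lead_coeff (fm T1).
by move/eqP; rewrite mulf_eq0 (negPf cT1) signr_eq0.
Qed.
End Evaluation.

Theorem theorem1p1 (n r : nat) (F : fieldType) (hnr : n = (2 * r)%N)
    (hn : (4 <= n)%N)
    (hF : ([pchar F]%R =i pred0) \/
          (exists2 p : nat, p \in [pchar F]%R & (r < p)%N)) :
  is_basis (fun T : symp_even_tableau r => pf_tableau F (sval T)).
Proof.
have nat0 := small_natr_neq0 hF.
split; last exact: pf_tableaux_independent.
by apply: pf_tableaux_spanning => //; [lia | apply: nat0; lia].
Qed.
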